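(* There is an absolute constant $c>0$ such that \[ \mathcal{C}_n\geq c\sqrt{\frac{n}{\log n}} \] for every integer $n\geq 3$.
   Context: A convex body is a compact convex set with nonempty interior. $\mathbb{S}^{n-1}$ is the Euclidean unit sphere of $\mathbb{R}^n$, and $\xi^\perp=\{x\in\mathbb{R}^n:\langle x,\xi\rangle=0\}$. For a continuous nonnegative $f$ on $\mathbb{R}^n$, $\mu_f(A)=\int_A f(x)\,dx$, and for a hyperplane $H$, $\mu_f(A\cap H)=\int_{A\cap H}f\,d\lambda_H$, where $\lambda_H$ is $(n-1)$-dimensional Lebesgue measure on $H$ (the same ambient density is restricted to $H$, with no normalization). For $n\ge2$, $\mathcal{C}_n$ is the infimum of all $C>0$ such that: whenever $f:\mathbb{R}^n\to(0,\infty)$ is even and continuous and $K,L\subset\mathbb{R}^n$ are origin-symmetric convex bodies satisfying $\mu_f(K\cap\xi^\perp)\leq\mu_f(L\cap\xi^\perp)$ for all $\xi\in\mathbb{S}^{n-1}$, then $\mu_f(K)\leq C\mu_f(L)$. ''Absolute constant'' means independent of $n$ and of all other parameters. *)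

(* Defs.v *)
From HB Require Import structures.
From mathcomp Require Import all_boot all_order all_algebra.
From mathcomp Require Import all_classical all_reals all_analysis.
From mathcomp Require Import ring.

Set Implicit Arguments.
Unset Strict Implicit.
Unset Printing Implicit Defensive.

Import Order.TTheory GRing.Theory Num.Theory.
Import numFieldNormedType.Exports.

Local Open Scope classical_set_scope.
Local Open Scope ring_scope.

(* 'rV[R]_n carries the sigma-algebra generated by the coordinate maps, i.e. *)
(* the product (equivalently Borel) sigma-algebra, as for n.-tuple R.        *)
Section measurable_rV.
Context {R : realType} {n : nat}.

Let coors : 'I_n -> 'rV[R]_n -> R := fun i x => x ord0 i.

Let rV_set0 : g_sigma_preimage coors set0.
Proof. exact: sigma_algebra0. Qed.

Let rV_setC A : g_sigma_preimage coors A -> g_sigma_preimage coors (~` A).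
Proof. exact: sigma_algebraC. Qed.

Let rV_bigcup (F : (set 'rV[R]_n)^nat) :
  (forall i, g_sigma_preimage coors (F i)) ->
  g_sigma_preimage coors (\bigcup_i (F i)).
Proof. exact: sigma_algebra_bigcup. Qed.

HB.instance Definition _ := @isMeasurable.Build default_measure_display
  'rV[R]_n (g_sigma_preimage coors) rV_set0 rV_setC rV_bigcup.

End measurable_rV.

Lemma measurable_coord (R : realType) n (i : 'I_n) :
  measurable_fun [set: 'rV[R]_n] (fun x : 'rV[R]_n => x ord0 i).
Proof.
move=> _ Y mY; rewrite setTI; apply: sub_sigma_algebra => /=.
rewrite -bigcup_seq/=; exists i => /=; first by rewrite mem_index_enum.
by exists Y => //; rewrite setTI.
Qed.

Lemma measurable_fun_rVP (R : realType) d (T : measurableType d) n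
    (f : T -> 'rV[R]_n) :
  measurable_fun [set: T] f <->
  forall i, measurable_fun [set: T] (fun x => f x ord0 i).
Proof.
pose c (i : 'I_n) (x : 'rV[R]_n) := x ord0 i.
apply: (@iff_trans _ (g_sigma_preimage (fun i => c i \o f) `<=` measurable)).
  rewrite g_sigma_preimage_comp; split=> [mf A [/= C preC <-]|prefS].
    exact: mf.
  by move=> _ A mA; apply: prefS; exists A.
split=> [cfS i|mf].
- move=> _ A mA.
  apply: cfS; apply: sub_sigma_algebra => /=.
  rewrite -bigcup_seq/=; exists i => /=; first by rewrite mem_index_enum.
  by exists A.
- apply: smallest_sub; first exact: sigma_algebra_measurable.
  rewrite -bigcup_seq/=; apply: bigcup_sub => i Ii.
  by move=> A [B mB <-]; exact: mf.
Qed.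

Definition rV_cons (R : realType) m (p : R * 'rV[R]_m) : 'rV[R]_m.+1 :=
  row_mx p.1%:M p.2.

Lemma rV_cons0 (R : realType) m (p : R * 'rV[R]_m) :
  rV_cons p ord0 ord0 = p.1.
Proof.
rewrite (_ : ord0 = lshift m ord0 :> 'I_(1 + m)); last exact: val_inj.
by apply: etrans (row_mxEl _ _ _ _) _; rewrite mxE eqxx.
Qed.

Lemma rV_consS (R : realType) m (p : R * 'rV[R]_m) (j : 'I_m) :
  rV_cons p ord0 (lift ord0 j) = p.2 ord0 j.
Proof.
rewrite (_ : lift ord0 j = rshift 1 j :> 'I_(1 + m)); last exact: val_inj.
exact: row_mxEr.
Qed.

Lemma measurable_rV_cons (R : realType) m :
  measurable_fun [set: R * 'rV[R]_m] (@rV_cons R m).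
Proof.
apply/measurable_fun_rVP => i.
have [j ->|->] := unliftP ord0 i.
  rewrite (_ : (fun _ => _) = (fun x : 'rV[R]_m => x ord0 j) \o snd).
    by apply: measurableT_comp => //; exact: measurable_coord.
  by apply/funext => p; rewrite rV_consS.
by rewrite (_ : (fun _ => _) = fst)//; apply/funext => p; rewrite rV_cons0.
Qed.

(* n-dimensional Lebesgue measure: lambda_0 is the unit mass and             *)
(* lambda_(m+1) is the product lambda_1 x lambda_m, carried by rV_cons.      *)
Fixpoint lebesgue_rV (R : realType) (n : nat) : set 'rV[R]_n -> \bar R :=
  match n with
  | 0 => \d_(0 : 'rV[R]_0)
  | m.+1 => pushforward (@lebesgue_measure R \x @lebesgue_rV R m)%E
                        (@rV_cons R m)
  end.

Section lebesgue_rV_measure.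
Local Open Scope ereal_scope.
Context (R : realType).

Let uncons m (x : 'rV[R]_m.+1) : R * 'rV[R]_m :=
  (x ord0 ord0, (\row_j x ord0 (lift ord0 j))%R).

Let rV_consK m : cancel (@rV_cons R m) (@uncons m).
Proof.
move=> [x v]; rewrite /uncons rV_cons0; congr pair.
by apply/rowP => j; rewrite mxE rV_consS.
Qed.

Let measurable_uncons m : measurable_fun setT (@uncons m).
Proof.
apply: measurable_fun_pair => /=; first exact: measurable_coord.
apply/measurable_fun_rVP => j.
under eq_fun do rewrite mxE.
exact: measurable_coord.
Qed.

Section cons.
Context (m : nat) (mu : {sigma_finite_measure set 'rV[R]_m -> \bar R}).

Let pmu := @lebesgue_measure R \x mu.
Let nu := pushforward pmu (@rV_cons R m).

Let nu0 : nu set0 = 0.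
Proof. by rewrite /nu /pushforward preimage_set0; exact: (measure0 pmu). Qed.

Let nu_ge0 A : 0 <= nu A.
Proof. exact: (measure_ge0 pmu). Qed.

Let nu_sigma_additive : semi_sigma_additive nu.
Proof.
move=> F mF tF mUF; rewrite /nu /pushforward preimage_bigcup.
apply: (measure_semi_sigma_additive (s := pmu)).
- by move=> k; rewrite -[X in measurable X]setTI; exact: measurable_rV_cons.
- apply/trivIsetP => /= i j _ _ ij; rewrite -preimage_setI.
  by move/trivIsetP : tF => /(_ _ _ _ _ ij) ->//; rewrite preimage_set0.
- rewrite -preimage_bigcup -[X in measurable X]setTI.
  exact: measurable_rV_cons.
Qed.

HB.instance Definition _ := isMeasure.Build _ _ _ nu
  nu0 nu_ge0 nu_sigma_additive.

Let nu_sigma_finite : sigma_finite setT nu.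
Proof.
have /sigma_finiteP[F [FT ndF Foo]] := sigma_finiteT (@lebesgue_measure R).
have /sigma_finiteP[G [GT ndG Goo]] := sigma_finiteT mu.
exists (fun k => @uncons m @^-1` (F k `*` G k)) => [|k].
  rewrite -preimage_bigcup (_ : \bigcup_k _ = setT) ?preimage_setT//.
  rewrite -setXTT FT GT predeqE => -[x y]; split.
    by move=> [k _ []/= ? ?]; split; exists k.
  move=> [/= [i _ Fix] [k _ Gky]]; exists (maxn i k) => //; split.
  - by move: x Fix; exact/subsetPset/ndF/leq_maxl.
  - by move: y Gky; exact/subsetPset/ndG/leq_maxr.
have [mF Fk] := Foo k; have [mG Gk] := Goo k; split.
  rewrite -[X in measurable X]setTI; apply: measurable_uncons => //.
  exact: measurableX.
rewrite /nu /pushforward -comp_preimage (_ : _ \o _ = id)/=; last first.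
  by apply/funext => p; exact: rV_consK.
by rewrite preimage_id [ltLHS]product_measure1E// lte_mul_pinfty// ge0_fin_numE.
Qed.

HB.instance Definition _ := Measure_isSigmaFinite.Build _ _ _ nu
  nu_sigma_finite.

Lemma sigma_finite_measure_rV_cons :
  exists mu' : {sigma_finite_measure set 'rV[R]_m.+1 -> \bar R}, nu = mu'.
Proof. by exists nu. Qed.

End cons.

Lemma sigma_finite_measure_rV n :
  exists mu : {sigma_finite_measure set 'rV[R]_n -> \bar R},
    @lebesgue_rV R n = mu.
Proof.
elim: n => [|m [mu muE]] /=; first by exists (\d_(0%R : 'rV[R]_0)).
by rewrite muE; exact: sigma_finite_measure_rV_cons.
Qed.

Context (n : nat).
Let lambda := @lebesgue_rV R n.

Let lambda0 : lambda set0 = 0.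
Proof. by rewrite /lambda; have [mu ->] := sigma_finite_measure_rV n. Qed.

Let lambda_ge0 A : 0 <= lambda A.
Proof. by rewrite /lambda; have [mu ->] := sigma_finite_measure_rV n. Qed.

Let lambda_sigma_additive : semi_sigma_additive lambda.
Proof.
rewrite /lambda; have [mu ->] := sigma_finite_measure_rV n.
exact: measure_semi_sigma_additive.
Qed.

HB.instance Definition _ := isMeasure.Build _ _ _ (@lebesgue_rV R n)
  lambda0 lambda_ge0 lambda_sigma_additive.

Let lambda_sigma_finite : sigma_finite setT lambda.
Proof.
rewrite /lambda; have [mu ->] := sigma_finite_measure_rV n.
exact: sigma_finiteT.
Qed.

HB.instance Definition _ := Measure_isSigmaFinite.Build _ _ _ (@lebesgue_rV R n)
  lambda_sigma_finite.

End lebesgue_rV_measure.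

Lemma lebesgue_rV_box (R : realType) n (A : 'I_n -> set R) :
  (forall i, measurable (A i)) ->
  lebesgue_rV [set x : 'rV[R]_n | forall i, A i (x ord0 i)] =
  (\prod_(i < n) lebesgue_measure (A i))%E.
Proof.
elim: n A => [|m IH] A mA.
  by rewrite big_ord0 /= diracE mem_set//=; case.
rewrite big_ord_recl -IH// /= /pushforward.
set B := [set v : 'rV[R]_m | _].
have mB : measurable B.
  rewrite (_ : B = \bigcap_(j in [set: 'I_m])
    ((fun v : 'rV[R]_m => v ord0 j) @^-1` A (lift ord0 j))).
    apply: fin_bigcap_measurable => // j _.
    by rewrite -[X in measurable X]setTI; exact: measurable_coord.
  by apply/seteqP; split => [v h j _|v h j]; exact: h.
rewrite (_ : _ @^-1` _ = A ord0 `*` B).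
  have H := @product_measure1E _ _ _ _ R (@lebesgue_measure R)
    (@lebesgue_rV R m) (A ord0) B (mA ord0) mB.
  exact: H.
apply/seteqP; split => -[x v] /=.
  move=> h; split => [|j]; first by have := h ord0; rewrite rV_cons0.
  by have := h (lift ord0 j); rewrite rV_consS.
move=> [h0 h] i; have [j ->|->] := unliftP ord0 i.
  by rewrite rV_consS; exact: h.
by rewrite rV_cons0.
Qed.

Section hyperplane.
Context {R : realType} {n : nat}.
Implicit Types x y xi : 'rV[R]_n.

Definition dotp x y : R := \sum_i x ord0 i * y ord0 i.

Definition unit_sphere : set 'rV[R]_n := [set x | Num.sqrt (dotp x x) = 1].

Definition perp xi : set 'rV[R]_n := [set x | dotp x xi = 0].

(* The rows of U form an orthonormal basis of the hyperplane perp xi. *)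
Definition perp_frame xi (U : 'M[R]_(n.-1, n)) :=
  (forall i j, dotp (row i U) (row j U) = (i == j)%:R) /\
  (forall i, perp xi (row i U)).

(* Lebesgue measure on perp xi: the image of (n-1)-dimensional Lebesgue      *)
(* measure by the linear isometry y |-> y *m U onto perp xi given by an      *)
(* orthonormal basis (perp_frame_ex); rotation invariance of Lebesgue        *)
(* measure makes the choice of U irrelevant.                                 *)
Definition lebesgue_perp xi : set 'rV[R]_n -> \bar R :=
  pushforward (@lebesgue_rV R n.-1)
    (fun y : 'rV[R]_n.-1 => y *m get (perp_frame xi)).

End hyperplane.

Section dotp_lemmas.
Context (R : realType) (n : nat).
Implicit Types x y z : 'rV[R]_n.

Lemma dotpC x y : dotp x y = dotp y x.
Proof. by apply: eq_bigr => i _; rewrite mulrC. Qed.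

Lemma dotpBr x y z : dotp x (y - z) = dotp x y - dotp x z.
Proof.
by rewrite /dotp -sumrB; apply: eq_bigr => i _; rewrite !mxE mulrBr.
Qed.

Lemma dotp_ge0 x : 0 <= dotp x x.
Proof. by apply: sumr_ge0 => i _; rewrite -expr2 sqr_ge0. Qed.

Lemma dotp_eq0 x : (dotp x x == 0) = (x == 0).
Proof.
apply/idP/eqP => [|->]; last by rewrite /dotp big1// => i _; rewrite mxE mul0r.
rewrite psumr_eq0 => [/allP x0|i _]; last by rewrite -expr2 sqr_ge0.
apply/rowP => i; rewrite mxE; apply/eqP.
by have := x0 i; rewrite mem_index_enum mulf_eq0 orbb => /(_ isT).
Qed.

Lemma mulmx_trdotp x y : x *m y^T = (dotp x y)%:M.
Proof.
apply/rowP => i; rewrite ord1 !mxE eqxx mulr1n.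
by apply: eq_bigr => j _; rewrite mxE.
Qed.

Lemma dotp_row m (U : 'M[R]_(m, n)) i j :
  dotp (row i U) (row j U) = (U *m U^T) i j.
Proof. by rewrite mxE; apply: eq_bigr => k _; rewrite !mxE. Qed.

End dotp_lemmas.

Lemma perp_frame_ex (R : realType) n (xi : 'rV[R]_n) :
  unit_sphere xi -> exists U, perp_frame xi U.
Proof.
case: n xi => [|n] xi; first by move=> _; exists 0; split => -[].
rewrite /unit_sphere /= => xi1.
have {}xi1 : dotp xi xi = 1.
  by rewrite -(sqr_sqrtr (dotp_ge0 xi)) xi1 expr1n.
have [H [HH H0]] : exists H : 'M[R]_n.+1, H *m H^T = 1%:M /\ row ord0 H = xi.
  pose e : 'rV[R]_n.+1 := delta_mx 0 0.
  have ee : dotp e e = 1.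
    rewrite /dotp (bigD1 ord0)//= big1 => [|i i0].
      by rewrite !mxE !eqxx mulr1 addr0.
    by rewrite !mxE (negbTE i0) andbF mul0r.
  have [xie|xie] := eqVneq xi e.
    by exists 1%:M; rewrite trmx1 mul1mx rowE mulmx1 xie.
  pose v := xi - e; pose c := dotp v v.
  have c0 : c != 0 by rewrite dotp_eq0 subr_eq0.
  have ev : 2 * dotp e v = - c.
    rewrite /c /v !dotpBr ![dotp (_ - _) _]dotpC !dotpBr xi1 ee (dotpC xi e).
    by ring.
  pose P := v^T *m v; pose k := 2 / c.
  have PP : P *m P = c *: P.
    by rewrite /P -mulmxA (mulmxA v) mulmx_trdotp mul_scalar_mx scalemxAr.
  have PT : P^T = P by rewrite /P trmx_mul trmxK.
  have eP : k *: (e *m P) = - v.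
    rewrite /P mulmxA mulmx_trdotp mul_scalar_mx scalerA /k -mulrA.
    by rewrite (mulrC c^-1) mulrA ev mulNr divff// scaleN1r.
  clearbody P; exists (1%:M - k *: P); split.
    rewrite [_^T]linearB/= trmx1 [(k *: P)^T]linearZ/= PT.
    rewrite mulmxBl !mulmxBr !mulmx1 mul1mx -!scalemxAl -!scalemxAr PP !scalerA.
    have -> : k * k * c = k + k by rewrite -mulrA {2}/k mulfVK//; ring.
    by rewrite scalerDl opprB addrK subrK.
  by rewrite rowE -/e mulmxBr mulmx1 -scalemxAr eP opprK addrC subrK.
exists (\matrix_i row (lift ord0 i) H).
have rH i : row i (\matrix_i row (lift ord0 i) H) = row (lift ord0 i) H.
  exact: rowK.
split => [i j|i]; first by rewrite !rH dotp_row HH mxE (inj_eq lift_inj).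
by rewrite rH /perp /= -H0 dotp_row HH mxE.
Qed.

Section lebesgue_perp_measure.
Local Open Scope ereal_scope.
Context (R : realType) (n : nat) (xi : 'rV[R]_n).

Let nu : set 'rV[R]_n -> \bar R := lebesgue_perp xi.

Let measurable_frame :
  measurable_fun setT (fun y : 'rV[R]_n.-1 => y *m get (perp_frame xi)).
Proof.
apply/measurable_fun_rVP => i; under eq_fun do rewrite mxE.
apply: measurable_sum => j; apply: measurable_realfun.measurable_funM => //.
exact: measurable_coord.
Qed.

Let nu0 : nu set0 = 0.
Proof.
by rewrite /nu /lebesgue_perp /pushforward preimage_set0; exact: measure0.
Qed.

Let nu_ge0 A : 0 <= nu A.
Proof. exact: (measure_ge0 (@lebesgue_rV R n.-1)). Qed.

Let nu_sigma_additive : semi_sigma_additive nu.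
Proof.
move=> F mF tF mUF; rewrite /nu /lebesgue_perp /pushforward preimage_bigcup.
apply: (measure_semi_sigma_additive (s := @lebesgue_rV R n.-1)).
- by move=> k; rewrite -[X in measurable X]setTI; exact: measurable_frame.
- apply/trivIsetP => /= i j _ _ ij; rewrite -preimage_setI.
  by move/trivIsetP : tF => /(_ _ _ _ _ ij) ->//; rewrite preimage_set0.
- rewrite -preimage_bigcup -[X in measurable X]setTI.
  exact: measurable_frame.
Qed.

HB.instance Definition _ := isMeasure.Build _ _ _ (lebesgue_perp xi)
  nu0 nu_ge0 nu_sigma_additive.

End lebesgue_perp_measure.

Section busemann_petty.
Context {R : realType} {n : nat}.
Implicit Types K L : set 'rV[R]_n.

Definition convex_body K :=
  [/\ convex_set (K : set (convex_lmodType 'rV[R]_n)), compact K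
    & K^° !=set0].

Definition origin_symmetric K := forall x, K x -> K (- x).

Definition mu_density (f : 'rV[R]_n -> R) (A : set 'rV[R]_n) : \bar R :=
  (\int[@lebesgue_rV R n]_(x in A) (f x)%:E)%E.

Definition mu_section (f : 'rV[R]_n -> R) (A : set 'rV[R]_n) xi : \bar R :=
  (\int[lebesgue_perp xi]_(x in A `&` perp xi) (f x)%:E)%E.

Definition comparison_const (C : R) :=
  forall (f : 'rV[R]_n -> R) K L,
    continuous f -> (forall x, 0 < f x) -> (forall x, f (- x) = f x) ->
    convex_body K -> origin_symmetric K ->
    convex_body L -> origin_symmetric L ->
    (forall xi, unit_sphere xi -> (mu_section f K xi <= mu_section f L xi)%E) ->
    (mu_density f K <= C%:E * mu_density f L)%E.

End busemann_petty.

(* Valued in \bar R, so that the infimum is +oo if there is no such C. *)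
Definition busemann_petty_const (R : realType) (n : nat) : \bar R :=
  ereal_inf [set C%:E | C in [set C : R | 0 < C /\ @comparison_const R n C]].

(* Main.v *)
(* Proof idea. Let f be the Gaussian e^{-|x|^2} plus equal narrow Gaussian    *)
(* bumps of width O(1) centred at +-a for polynomially many points a of norm  *)
(* about R = n / sqrt (ln n). L is the ball of radius sqrt (2n), which        *)
(* carries most of the central Gaussian and almost nothing of the bumps. K is *)
(* the convex hull of the +-a thickened by a small multiple of sqrt n, which  *)
(* carries most of the bumps. For a Gaussian x in any hyperplane, h_K(x) <=   *)
(* max |<a,x>| + c sqrt n |x| is smaller than |x|^2 ~ n, so the sections of K *)
(* miss most of the central Gaussian. For a good choice of the points a, a    *)
(* hyperplane through the origin meets only a fraction O(sqrt n / R) of the   *)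
(* bumps, so the total bump mass can be taken of order R / sqrt n = sqrt (n / *)
(* ln n) while every section of K stays below that of L. In low dimension the *)
(* choice K = L suffices.                                                     *)

Require Import Defs.
From mathcomp Require Import all_boot all_order all_algebra.
From mathcomp Require Import all_classical all_reals all_analysis.
From mathcomp Require Import measurable_realfun normal_distribution.
From mathcomp Require Import ring lra.
Import Order.TTheory GRing.Theory Num.Theory.
Import numFieldNormedType.Exports.
Local Open Scope classical_set_scope.
Local Open Scope ring_scope.

Set Implicit Arguments.
Unset Strict Implicit.
Unset Printing Implicit Defensive.

(** L holds the central Gaussian, K holds the far bumps, and hyperplanes through the origin see few
    bumps. A hyperplane with unit normal xi sees a bump centred at a only through the factor
    e^{-k<a,xi>^2} ([integral_perp_gaussian]), which is small unless the hyperplane passes within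
    O(1) of a. For |a| about n / sqrt(ln n), a typical <a,xi> has size sqrt(n / ln n), so the factor
    averages about sqrt(ln n / n), the order of [rate]. [exists_points] produces n^3 centres for
    which this average holds, up to a constant, for all xi at once. Bumps of total mass about
    1/[rate] times the central Gaussian therefore add only a small fraction of the Gaussian to any
    section.

    The logarithm comes from the sections of K ([mu_section_hull_le]). A Gaussian x lies in K only
    if it is short or some |<a,x>| is of order n. These inner products have size |a|, so a union
    bound over n^3 centres requires |a| sqrt(ln n) to be at most a small multiple of n.

    [mu_section_hull_le_ball] checks the hypothesis on sections; [mu_density_hull_ge] and
    [mu_density_ball_le] compare the total masses, and [comparison_const_ge_large] concludes. Every
    estimate dominates the integrand pointwise by Gaussians with explicit integrals. *)

Section integral_mono.
Local Open Scope ereal_scope.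
Context d (T : measurableType d) (R : realType).
Variable mu : {measure set T -> \bar R}.
Import HBNNSimple.

(* The integral of a nonnegative function is a supremum over the simple *)
(* functions below it, so no measurability is needed.                   *)
Lemma ge0_le_integral_subset (D E : set T) (f g : T -> \bar R) :
  D `<=` E -> (forall x, D x -> 0 <= f x) -> (forall x, E x -> 0 <= g x) ->
  (forall x, D x -> f x <= g x) ->
  \int[mu]_(x in D) f x <= \int[mu]_(x in E) g x.
Proof.
move=> DE f0 g0 fg; rewrite (integral_mkcond D) (integral_mkcond E).
have h0 x : 0 <= (f \_ D) x by apply: erestrict_ge0.
have k0 x : 0 <= (g \_ E) x by apply: erestrict_ge0.
rewrite !ge0_integralTE//; apply: ereal_sup_le => _ [h /= hf <-].
exists h => // x; apply: le_trans (hf x) _.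
rewrite /patch; case: ifPn => [/set_mem Dx|_].
  by rewrite mem_set ?fg//; exact: DE.
by case: ifPn => // /set_mem; exact: g0.
Qed.

(** The part of the integral of [f] lost outside [D] is at most [b]. With a Chernoff majorant as
    [g], this shows that a body catches most of a Gaussian. *)
Lemma ge0_integral_ge (D : set T) (f g : T -> R) (a b : R) :
  measurable D -> measurable_fun setT f -> measurable_fun setT g ->
  (forall x, (0 <= f x)%R) -> (forall x, (0 <= g x)%R) ->
  \int[mu]_x (f x)%:E = a%:E -> \int[mu]_x (g x)%:E = b%:E ->
  (forall x, ~ D x -> (f x <= g x)%R) ->
  (a - b)%:E <= \int[mu]_(x in D) (f x)%:E.
Proof.
move=> mD mf mg f0 g0 fa gb fg.
have mfE : measurable_fun setT (fun x => (f x)%:E) by exact/measurable_EFinP.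
rewrite EFinB leeBlDr// -fa -gb -(setvU D) ge0_integral_setU//=; last 4 first.
- exact: measurableC.
- by rewrite setvU.
- by move=> x _; rewrite lee_fin.
- by rewrite disj_set2E setICl.
rewrite addeC leeD2l// setvU.
by apply: ge0_le_integral_subset => // x Dx; rewrite lee_fin//.
Qed.

End integral_mono.

(** * Gaussian integrals on R^n and on hyperplanes *)

Section rV_integral.
Context (R : realType).

Lemma integral_rV_cons m (f : 'rV[R]_m.+1 -> \bar R) :
  measurable_fun setT f -> (forall x, 0 <= f x)%E ->
  (\int[@lebesgue_rV R m.+1]_x f x =
   \int[lebesgue_measure]_t \int[@lebesgue_rV R m]_y f (rV_cons (t, y)))%E.
Proof.
move=> mf f0.
pose m1 : {sigma_finite_measure set (measurableTypeR R) -> \bar R} := @lebesgue_measure R.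
pose m2 : {sigma_finite_measure set 'rV[R]_m -> \bar R} := @lebesgue_rV R m.
transitivity (\int[pushforward (m1 \x m2)%E (@rV_cons R m)]_x f x)%E.
  by [].
have mc : measurable_fun setT
    (@rV_cons R m : (measurableTypeR R * 'rV[R]_m)%type -> _) :=
  @measurable_rV_cons R m.
have H := @ge0_integral_pushforward _ _ _ _ R _ mc (m1 \x m2)%E setT f
  measurableT mf (fun x _ => f0 x).
apply: etrans H _.
have H2 := @fubini_tonelli1 _ _ _ _ R m1 m2 (f \o @rV_cons R m)
  (measurableT_comp mf mc) (fun x => f0 _).
by rewrite preimage_setT; exact: H2.
Qed.

Lemma measurable_dotp d (T : measurableType d) n (f g : T -> 'rV[R]_n) :
  measurable_fun setT f -> measurable_fun setT g ->
  measurable_fun setT (fun x => dotp (f x) (g x)).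
Proof.
move=> /measurable_fun_rVP mf /measurable_fun_rVP mg.
by apply: measurable_sum => i; exact: measurable_funM.
Qed.

Lemma measurable_rVB d (T : measurableType d) n (f g : T -> 'rV[R]_n) :
  measurable_fun setT f -> measurable_fun setT g ->
  measurable_fun setT (fun x => f x - g x).
Proof.
move=> /measurable_fun_rVP mf /measurable_fun_rVP mg.
apply/measurable_fun_rVP => i; under eq_fun do rewrite !mxE.
exact: measurable_funB.
Qed.

Lemma measurable_gaussian n k (a : 'rV[R]_n) :
  measurable_fun setT (fun x : 'rV[R]_n => expR (- k * dotp (x - a) (x - a))).
Proof.
apply: measurableT_comp => //; apply: measurable_funM => //.
by apply: measurable_dotp; apply: measurable_rVB.
Qed.

Lemma measurable_ball n (r : R) (a : 'rV[R]_n) :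
  measurable [set x : 'rV[R]_n | dotp (x - a) (x - a) <= r].
Proof.
have m : measurable_fun setT (fun x : 'rV[R]_n => dotp (x - a) (x - a)).
  by apply: measurable_dotp; apply: measurable_rVB.
have := m measurableT _ (measurable_itv `]-oo, r]).
by rewrite setTI; congr measurable; apply/seteqP; split => x; rewrite /= in_itv.
Qed.

Definition gaussJ (k : R) : R := Num.sqrt (pi / k).

Lemma gaussJ_gt0 k : 0 < k -> 0 < gaussJ k.
Proof. by move=> k0; rewrite sqrtr_gt0 divr_gt0// pi_gt0. Qed.

Lemma gaussJM k c : 0 < k -> 0 < c -> gaussJ (c * k) = gaussJ k / Num.sqrt c.
Proof.
move=> k0 c0; rewrite /gaussJ invfM mulrCA mulrC sqrtrM ?sqrtrV ?ltW//.
by rewrite divr_gt0// pi_gt0.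
Qed.

Lemma integral_gaussian1 (k a : R) : 0 < k ->
  (\int[lebesgue_measure]_t (expR (- k * (t - a) ^+ 2))%:E = (gaussJ k)%:E)%E.
Proof.
move=> k0; pose s := (Num.sqrt (2 * k))^-1.
have s0 : s != 0 by rewrite invr_neq0// gt_eqF// sqrtr_gt0 mulr_gt0.
have s2 : s ^+ 2 = (2 * k)^-1 by rewrite exprVn sqr_sqrtr// mulr_ge0 ?ltW.
have JE : normal_peak s = (gaussJ k)^-1.
  rewrite /normal_peak /gaussJ s2; congr (Num.sqrt _)^-1.
  by rewrite -mulr_natr; field; rewrite gt_eqF.
have := integral_normal_pdf a s.
under eq_integral => x _.
  rewrite normal_pdfE//.
  rewrite /= JE EFinM.
  rewrite (_ : normal_fun _ _ _ = expR (- k * (x - a) ^+ 2)); last first.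
    rewrite /normal_fun s2; congr expR; rewrite -mulr_natr; field.
    by rewrite gt_eqF.
  over.
rewrite ge0_integralZl//; last first.
- by rewrite lee_fin invr_ge0 ltW// gaussJ_gt0.
- apply/measurable_EFinP; apply: measurableT_comp => //.
  apply: measurable_funM => //; apply: measurable_funX.
  exact: measurable_funB.
have J0 := gaussJ_gt0 k0.
move=> /(congr1 (fun z => (gaussJ k)%:E * z)%E).
by rewrite muleA -EFinM divff ?gt_eqF// mul1e mule1.
Qed.

Lemma dotp_cons m (t u : R) (y z : 'rV[R]_m) :
  dotp (rV_cons (t, y)) (rV_cons (u, z)) = t * u + dotp y z.
Proof.
rewrite /dotp big_ord_recl !rV_cons0; congr (_ + _).
by apply: eq_bigr => i _; rewrite !rV_consS.
Qed.

Lemma rV_consB m (t u : R) (y z : 'rV[R]_m) :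
  rV_cons (t, y) - rV_cons (u, z) = rV_cons (t - u, y - z).
Proof.
apply/rowP => i; rewrite [LHS]mxE [X in _ + X]mxE.
have [j ->|->] := unliftP ord0 i; first by rewrite !rV_consS /= !mxE.
by rewrite !rV_cons0.
Qed.

Lemma rV_consP m (a : 'rV[R]_m.+1) : exists u z, a = rV_cons (u, z).
Proof.
exists (a ord0 ord0), (\row_j a ord0 (lift ord0 j)); apply/rowP => i.
have [j ->|->] := unliftP ord0 i; first by rewrite rV_consS mxE.
by rewrite rV_cons0.
Qed.

Lemma integral_gaussian n k (a : 'rV[R]_n) : 0 < k ->
  (\int[@lebesgue_rV R n]_x (expR (- k * dotp (x - a) (x - a)))%:E =
   (gaussJ k ^+ n)%:E)%E.
Proof.
move=> k0; elim: n a => [|m IH] a.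
  rewrite expr0 integral_dirac//=; last first.
    by apply/measurable_EFinP; exact: measurable_gaussian.
  by rewrite diracT mul1e /dotp big_ord0 mulr0 expR0.
rewrite integral_rV_cons; last 2 first.
- by apply/measurable_EFinP; exact: measurable_gaussian.
- by move=> x; rewrite lee_fin expR_ge0.
have [u [z ->]] := rV_consP a.
under eq_integral => t _.
  under eq_integral => y _.
    rewrite rV_consB dotp_cons mulrDr expRD EFinM.
    over.
  rewrite ge0_integralZl//; last first.
    by apply/measurable_EFinP; exact: measurable_gaussian.
  rewrite IH muleC -expr2.
  over.
rewrite ge0_integralZl//; last 2 first.
- apply/measurable_EFinP; apply: measurableT_comp => //.
  apply: measurable_funM => //; apply: measurable_funX.
  exact: measurable_funB.
- by rewrite lee_fin exprn_ge0// ltW// gaussJ_gt0.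
by rewrite integral_gaussian1// -EFinM exprSr.
Qed.

End rV_integral.

Section gaussian_sections.
Context (R : realType).

(** Completing the square: with q = 1 + k a^2 / b, the leading coefficient is q b and the remainder
    is (k / q) c^2. *)
Lemma integral_gaussian_quad1 (b k a c : R) : 0 < b -> 0 <= k ->
  (\int[lebesgue_measure]_t
     (expR (- b * (t * t) - k * (t * a + c) ^+ 2))%:E =
   (gaussJ b / Num.sqrt (1 + k * (a * a) / b) *
    expR (- (k / (1 + k * (a * a) / b)) * c ^+ 2))%:E)%E.
Proof.
move=> b0 k0; have q0 : 0 < 1 + k * (a * a) / b.
  by rewrite ltr_pwDl// divr_ge0 ?(ltW b0)// mulr_ge0// -expr2 sqr_ge0.
set q := _ + _ in q0 *.
have bq : q * b = b + k * (a * a) by rewrite /q; field; rewrite gt_eqF.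
have qb0 : 0 < q * b by rewrite mulr_gt0.
rewrite -gaussJM// mulrC EFinM -(integral_gaussian1 (- (k * a * c / (q * b))) qb0).
rewrite -ge0_integralZl//; last first.
  apply/measurable_EFinP; apply: measurableT_comp => //.
  by apply: measurable_funM => //; apply: measurable_funX; exact: measurable_funB.
apply: eq_integral => t _; rewrite -EFinM -expRD; congr (expR _)%:E.
have -> : k / q = k * b / (q * b) by field; rewrite !gt_eqF.
by rewrite bq in qb0 *; field; rewrite gt_eqF.
Qed.

(** The offset [c] serves the induction: splitting off a coordinate t replaces c by t a + c, and the
    inner integral leaves a one-dimensional integrand of the same shape with k / q for k. *)
Lemma integral_gaussian_quad n (b k c : R) (v : 'rV[R]_n) : 0 < b -> 0 <= k ->
  (\int[@lebesgue_rV R n]_x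
     (expR (- b * dotp x x - k * (dotp x v + c) ^+ 2))%:E =
   (gaussJ b ^+ n / Num.sqrt (1 + k * dotp v v / b) *
    expR (- (k / (1 + k * dotp v v / b)) * c ^+ 2))%:E)%E.
Proof.
move=> b0; elim: n k c v => [|m IH] k c v k0.
  have m0 : measurable_fun setT (fun x : 'rV[R]_0 =>
      expR (- b * dotp x x - k * (dotp x v + c) ^+ 2)).
    rewrite (_ : (fun _ => _) = cst (expR (- k * c ^+ 2)))//.
    apply/funext => x; rewrite /dotp !big_ord0 mulr0 !add0r.
    by rewrite mulNr.
  rewrite expr0 integral_dirac//=; last exact/measurable_EFinP.
  rewrite diracT mul1e /dotp !big_ord0 !(mulr0,mul0r,addr0,add0r).
  by rewrite sqrtr1 !divr1 mul1r mulNr.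
have mq p (u w : 'rV[R]_p) e : measurable_fun setT (fun x : 'rV[R]_p =>
    expR (- b * dotp x x - k * (dotp x w + e) ^+ 2)).
  apply: measurableT_comp => //; apply: measurable_funB.
    by apply: measurable_funM => //; exact: measurable_dotp.
  apply: measurable_funM => //; apply: measurable_funX.
  by apply: measurable_funD => //; exact: measurable_dotp.
rewrite integral_rV_cons; last 2 first.
- by apply/measurable_EFinP; exact: mq.
- by move=> x; rewrite lee_fin expR_ge0.
have [a [w ->]] := rV_consP v.
have w0 : 0 <= k * dotp w w / b.
  by rewrite divr_ge0 ?(ltW b0)// mulr_ge0// dotp_ge0.
have q0 : 0 < 1 + k * dotp w w / b by rewrite ltr_pwDl.
under eq_integral => t _.
  under eq_integral => y _.
    rewrite !dotp_cons mulrDr -addrA expRD EFinM (addrC (t * a)) -[in X in _ - X]addrA.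
    over.
  rewrite ge0_integralZl//; last first.
    by apply/measurable_EFinP; exact: mq.
  rewrite IH// EFinM muleCA -EFinM -expRD (mulNr (k / _)) EFinM.
  over.
set q := 1 + _ in q0 *.
rewrite ge0_integralZl//; last 2 first.
- apply/measurable_EFinP; apply: measurableT_comp => //.
  apply: measurable_funB.
    by apply: measurable_funM => //; exact: measurable_funM.
  apply: measurable_funM => //; apply: measurable_funX.
  by apply: measurable_funD => //; exact: measurable_funM.
- by rewrite lee_fin divr_ge0// exprn_ge0// ltW// gaussJ_gt0.
rewrite integral_gaussian_quad1//; last by rewrite divr_ge0// ltW.
rewrite -EFinM; congr EFin.
rewrite dotp_cons (exprSr (gaussJ b)).
have -> : 1 + k * (a * a + dotp w w) / b = q * (1 + k / q * (a * a) / b).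
  have bkw : b + k * dotp w w != 0.
    by rewrite gt_eqF// ltr_pwDl// mulr_ge0// dotp_ge0.
  by rewrite /q; field; rewrite bkw gt_eqF.
set q1 := 1 + k / q * (a * a) / b.
rewrite (sqrtrM q1) ?(ltW q0)// !invfM -!mulrA; congr (_ * _).
rewrite mulrCA; congr (_ * (_ * (_ * _))).
Qed.

Lemma unit_sphere_dotp n (xi : 'rV[R]_n) : unit_sphere xi -> dotp xi xi = 1.
Proof.
by rewrite /unit_sphere /= => h; rewrite -(sqr_sqrtr (dotp_ge0 xi)) h expr1n.
Qed.

Lemma perp_frame_orthonormal n (xi : 'rV[R]_n) (U : 'M[R]_(n.-1, n)) :
  perp_frame xi U -> U *m U^T = 1%:M.
Proof. by move=> [UU _]; apply/matrixP => i j; rewrite -dotp_row UU mxE. Qed.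

Lemma perp_frame_mul_tr n (xi : 'rV[R]_n) (U : 'M[R]_(n.-1, n)) :
  perp_frame xi U -> U *m xi^T = 0.
Proof.
move=> [_ Uxi]; apply/matrixP => i j; rewrite ord1 [RHS]mxE -(Uxi i) mxE.
by apply: eq_bigr => k _; rewrite !mxE.
Qed.

(** Stacking [xi] on [U] gives a square matrix with orthonormal rows, hence with orthonormal
    columns. *)
Lemma perp_frame_dotp n (xi x : 'rV[R]_n) (U : 'M[R]_(n.-1, n)) :
  unit_sphere xi -> perp_frame xi U ->
  dotp x x = dotp (x *m U^T) (x *m U^T) + dotp x xi ^+ 2.
Proof.
case: n xi x U => [|m] xi x U.
  by rewrite /unit_sphere /= /dotp big_ord0 sqrtr0 => /esym/eqP; rewrite oner_eq0.
move=> /unit_sphere_dotp xi1 xiU.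
have UxiT := perp_frame_mul_tr xiU; have UUT := perp_frame_orthonormal xiU.
pose W : 'M[R]_(1 + m, m.+1) := col_mx xi U.
have WW : W *m W^T = 1%:M.
  rewrite /W tr_col_mx mul_col_row mulmx_trdotp xi1 UxiT UUT.
  have -> : xi *m U^T = 0 by rewrite -[LHS]trmxK trmx_mul trmxK UxiT trmx0.
  by rewrite scalar_mx_block.
have {}WW : xi^T *m xi + U^T *m U = 1%:M.
  rewrite -(@mul_row_col _ _ _ _ _ xi^T U^T xi U) -tr_col_mx.
  exact: (@mulmx1C R m.+1 W W^T WW).
have : x *m x^T = x *m U^T *m (x *m U^T)^T + x *m xi^T *m (x *m xi^T)^T.
  rewrite !trmx_mul !trmxK -!mulmxA -mulmxDr; congr (_ *m _).
  by rewrite !mulmxA -mulmxDl addrC WW mul1mx.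
rewrite (mulmx_trdotp x xi) tr_scalar_mx -scalar_mxM !mulmx_trdotp.
by move=> /matrixP /(_ 0 0); rewrite !mxE !mulr1n.
Qed.

Lemma perp_frameP n (xi : 'rV[R]_n) : unit_sphere xi ->
  perp_frame xi (get (perp_frame xi)).
Proof. by move=> /perp_frame_ex h; exact: getPex. Qed.

Lemma perp_frame_perp n (xi : 'rV[R]_n) (U : 'M[R]_(n.-1, n)) y :
  perp_frame xi U -> perp xi (y *m U).
Proof.
move=> xiU; have := mulmx_trdotp (y *m U) xi.
rewrite -mulmxA (perp_frame_mul_tr xiU) mulmx0 => /matrixP /(_ 0 0).
by rewrite !mxE eqxx mulr1n /perp /= => <-.
Qed.

Lemma measurable_mulmxr m n (U : 'M[R]_(m, n)) :
  measurable_fun setT (fun y : 'rV[R]_m => y *m U).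
Proof.
apply/measurable_fun_rVP => i; under eq_fun do rewrite mxE.
apply: measurable_sum => j; apply: measurable_funM => //.
exact: measurable_coord.
Qed.

Lemma integral_perp n (xi : 'rV[R]_n) (D : set 'rV[R]_n)
    (f : 'rV[R]_n -> \bar R) :
  measurable D -> measurable_fun D f -> (forall x, 0 <= f x)%E ->
  (\int[lebesgue_perp xi]_(x in D) f x =
   \int[@lebesgue_rV R n.-1]_(y in
     (fun y => y *m get (perp_frame xi)) @^-1` D)
     f (y *m get (perp_frame xi)))%E.
Proof.
move=> mD mf f0.
exact: (ge0_integral_pushforward (@measurable_mulmxr _ _ (get (perp_frame xi)))
  (@lebesgue_rV R n.-1) mD mf (fun x _ => f0 x)).
Qed.

Lemma dotp_subU n (xi a : 'rV[R]_n) (y : 'rV[R]_n.-1) (U : 'M[R]_(n.-1, n)) :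
  unit_sphere xi -> perp_frame xi U ->
  dotp (y *m U - a) (y *m U - a) =
  dotp (y - a *m U^T) (y - a *m U^T) + dotp a xi ^+ 2.
Proof.
move=> xi1 xiU; rewrite (perp_frame_dotp _ xi1 xiU); congr (_ + _).
  by rewrite mulmxBl -mulmxA (perp_frame_orthonormal xiU) mulmx1.
rewrite dotpC dotpBr (dotpC xi) (perp_frame_perp y xiU : _ = 0).
by rewrite sub0r sqrrN dotpC.
Qed.

(** By Pythagoras, on the hyperplane the bump is a Gaussian around the projection of [a], damped by
    the squared distance from [a] to the hyperplane. *)
Lemma integral_perp_gaussian n k (xi a : 'rV[R]_n) : 0 < k -> unit_sphere xi ->
  (\int[lebesgue_perp xi]_x (expR (- k * dotp (x - a) (x - a)))%:E =
   (gaussJ k ^+ n.-1 * expR (- k * dotp a xi ^+ 2))%:E)%E.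
Proof.
move=> k0 xi1; rewrite integral_perp//; last first.
  by apply/measurable_EFinP; exact: measurable_gaussian.
rewrite preimage_setT.
under eq_integral => y _.
  rewrite (dotp_subU _ _ xi1 (perp_frameP xi1)) mulrDr expRD mulrC EFinM.
  over.
rewrite ge0_integralZl//; last first.
  by apply/measurable_EFinP; exact: measurable_gaussian.
by rewrite integral_gaussian// -EFinM mulrC.
Qed.

End gaussian_sections.

(** * The convex bodies *)

Section dotp_theory.
Context (R : realType) (n : nat).
Implicit Types x y z a : 'rV[R]_n.

Lemma dotpDr x y z : dotp x (y + z) = dotp x y + dotp x z.
Proof.
by rewrite /dotp -big_split; apply: eq_bigr => i _; rewrite !mxE mulrDr.
Qed.

Lemma dotpZr (c : R) x y : dotp x (c *: y) = c * dotp x y.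
Proof.
by rewrite /dotp mulr_sumr; apply: eq_bigr => i _; rewrite !mxE mulrCA.
Qed.

Lemma dotpNr x y : dotp x (- y) = - dotp x y.
Proof. by rewrite -scaleN1r dotpZr mulN1r. Qed.

Lemma dotpDl x y z : dotp (x + y) z = dotp x z + dotp y z.
Proof. by rewrite dotpC dotpDr !(dotpC z). Qed.

Lemma dotpZl (c : R) x y : dotp (c *: x) y = c * dotp x y.
Proof. by rewrite dotpC dotpZr dotpC. Qed.

Lemma dotpNl x y : dotp (- x) y = - dotp x y.
Proof. by rewrite dotpC dotpNr dotpC. Qed.

Lemma dotpNN x : dotp (- x) (- x) = dotp x x.
Proof. by rewrite dotpNl dotpNr opprK. Qed.

Lemma dotp0l x : dotp 0 x = 0.
Proof. by rewrite -[0](scale0r x) dotpZl mul0r. Qed.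

Lemma dotp_sqrB x y : dotp (x - y) (x - y) = dotp x x - 2 * dotp x y + dotp y y.
Proof. by rewrite dotpDl !dotpDr !dotpNl !dotpNr (dotpC y x); ring. Qed.

Lemma dotp_CauchySchwarz x y : dotp x y ^+ 2 <= dotp x x * dotp y y.
Proof.
have [y0|y0] := eqVneq (dotp y y) 0.
  move/eqP: y0; rewrite dotp_eq0 => /eqP ->.
  by rewrite dotpC !dotp0l expr0n mulr0.
have cy : 0 < dotp y y by rewrite lt_neqAle eq_sym y0 dotp_ge0.
have := dotp_ge0 (dotp y y *: x - dotp x y *: y).
rewrite dotp_sqrB !dotpZl !dotpZr -(pmulr_rge0 _ cy) => h.
rewrite -subr_ge0 -(pmulr_rge0 _ cy) -(pmulr_rge0 _ cy).
by apply: le_trans h _; rewrite le_eqVlt; apply/orP; left; apply/eqP; ring.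
Qed.

Lemma dotp_le_sqrt x y : dotp x y <= Num.sqrt (dotp x x) * Num.sqrt (dotp y y).
Proof.
rewrite -sqrtrM ?dotp_ge0//; apply: le_trans (ler_norm _) _.
by rewrite -sqrtr_sqr ler_wsqrtr// dotp_CauchySchwarz.
Qed.

(** This is |2x - a|^2 >= 0 in disguise. It keeps the far bumps away from the ball. *)
Lemma dotp_sqrB_ge x a : dotp a a / 2 - dotp x x <= dotp (x - a) (x - a).
Proof.
have := dotp_ge0 (2 *: x - a).
rewrite !dotp_sqrB dotpZl dotpZl dotpZr.
lra.
Qed.

Lemma coord_sqr_le_dotp x i : x ord0 i ^+ 2 <= dotp x x.
Proof.
rewrite /dotp (bigD1 i)//= -expr2 lerDl; apply: sumr_ge0 => j _.
by rewrite -expr2 sqr_ge0.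
Qed.

Lemma continuous_sumr (T : topologicalType) (I : Type) (s : seq I)
  (f : I -> T -> R) : (forall i, continuous (f i)) ->
  continuous (fun t => \sum_(i <- s) f i t).
Proof.
move=> cf; elim: s => [|i s IH] t.
  by under eq_fun do rewrite big_nil; exact: cvg_cst.
under eq_fun do rewrite big_cons.
by apply: cvgD; [exact: cf|exact: IH].
Qed.

Lemma continuous_dotp (T : topologicalType) (f g : T -> 'rV[R]_n) :
  continuous f -> continuous g -> continuous (fun t => dotp (f t) (g t)).
Proof.
move=> cf cg; apply: continuous_sumr => i t; apply: cvgM.
  by apply: (@continuous_comp _ _ _ f (fun v : 'rV[R]_n => v ord0 i));
    [exact: cf|exact: coord_continuous].
by apply: (@continuous_comp _ _ _ g (fun v : 'rV[R]_n => v ord0 i));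
    [exact: cg|exact: coord_continuous].
Qed.

End dotp_theory.

Section neighborhood_body.
Context (R : realType) (n : nat).
Implicit Types (s : seq 'rV[R]_n) (x y z : 'rV[R]_n) (r T : R).

(* The r-neighbourhood of the convex hull of the points a and -a, a in s,  *)
(* described through its support function: every convexity, closedness and *)
(* symmetry property is then immediate. For s = [::] it is a ball.         *)
Definition hull_body s r : set 'rV[R]_n :=
  [set y | forall z T, 0 <= T -> (forall a, a \in s -> `|dotp a z| <= T) ->
     dotp y z <= T + r * Num.sqrt (dotp z z)].

Lemma hull_body_ball s r x : 0 <= r -> dotp x x <= r ^+ 2 -> hull_body s r x.
Proof.
move=> r0 xr z T T0 _; apply: le_trans (dotp_le_sqrt x z) _.
rewrite -[leLHS]add0r; apply: lerD => //; apply: ler_wpM2r => //.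
by rewrite -(ger0_norm r0) -sqrtr_sqr ler_wsqrtr.
Qed.

Lemma hull_body_near s r a x : 0 <= r -> a \in s ->
  dotp (x - a) (x - a) <= r ^+ 2 -> hull_body s r x.
Proof.
move=> r0 sa xr z T T0 sT; rewrite -(subrK a x) dotpDl addrC; apply: lerD.
  by apply: le_trans (ler_norm _) _; exact: sT.
have := @hull_body_ball [::] r _ r0 xr z 0 (lexx _).
by rewrite add0r; apply.
Qed.

Lemma hull_body_nilP r x : 0 <= r -> hull_body [::] r x <-> dotp x x <= r ^+ 2.
Proof.
(* Testing membership with z = x and T = 0 gives |x|^2 <= r |x|. *)
move=> r0; split => [/(_ x 0 (lexx _))|]; last exact: hull_body_ball.
rewrite add0r => /(_ (fun _ => ltac:(by [])))  xr.
set q := Num.sqrt (dotp x x) in xr.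
have q2 : q ^+ 2 = dotp x x by rewrite sqr_sqrtr// dotp_ge0.
have [q0|q0] := eqVneq q 0; first by rewrite -q2 q0 expr0n/= sqr_ge0.
have qp : 0 < q by rewrite lt_neqAle eq_sym q0 sqrtr_ge0.
by rewrite -q2 ler_sqr ?nnegrE ?(ltW qp)// -(ler_pM2r qp) -expr2 q2.
Qed.

Lemma hull_body_symmetric s r : origin_symmetric (hull_body s r).
Proof.
move=> y Ky z T T0 sT; rewrite dotpNl -dotpNr -(dotpNN z).
by apply: Ky => // a /sT; rewrite dotpNr normrN.
Qed.

Lemma hull_body_convex s r :
  convex_set (hull_body s r : set (convex_lmodType 'rV[R]_n)).
Proof.
move=> x y t; rewrite !inE => Kx Ky z T T0 sT.
have Hx := Kx z T T0 sT; have Hy := Ky z T T0 sT.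
set B := T + _ in Hx Hy *.
rewrite [X in dotp X _](_ : _ = t%:num *: (x : 'rV_n) + (1 - t%:num) *: (y : 'rV_n))//.
have t0 : 0 <= t%:num by [].
have t1 : t%:num <= 1 by [].
rewrite dotpDl !dotpZl.
have := ler_wpM2l t0 Hx; have := @ler_wpM2l _ (1 - t%:num) _ _ _ Hy.
rewrite subr_ge0 => /(_ t1); lra.
Qed.

Lemma hull_body_closed s r : closed (hull_body s r).
Proof.
pose D := [set p : 'rV[R]_n * R | 0 <= p.2 /\
  forall a, a \in s -> `|dotp a p.1| <= p.2].
rewrite (_ : hull_body s r = \bigcap_(p in D)
    [set y | dotp y p.1 <= p.2 + r * Num.sqrt (dotp p.1 p.1)]).
  apply: closed_bigI => -[z T] _ /=.
  rewrite (_ : [set y | _] =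
    (fun y => dotp y z) @^-1` [set u | u <= T + r * Num.sqrt (dotp z z)])//.
  apply: preimage_closed; last exact: closed_le.
  have cz : continuous (fun y : 'rV[R]_n => dotp y z).
    apply: (@continuous_dotp R n _ id (fun _ => z)) => w.
      exact: cvg_id.
    exact: (@cvg_cst _ z _ (nbhs w) _).
  by move=> y _; exact: cz.
apply/seteqP; split => [y Ky [z T] /= [T0 sT]|y Ky z T T0 sT].
  exact: Ky.
exact: (Ky (z, T)).
Qed.

Lemma hull_body_compact s r : compact (hull_body s r).
Proof.
(* Bound for the i-th coordinate, obtained by testing with the i-th basis vector and T = sum of the
   |a_i|. *)
pose B i := \sum_(a <- s) `|a ord0 i| + `|r|.
apply: (@subclosed_compact _ _
  [set v : 'rV[R]_n | forall i, `[- B i, B i]%classic (v ord0 i)]).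
- exact: hull_body_closed.
- apply: (@rV_compact _ n (fun i => `[- B i, B i]%classic)) => i.
  exact: segment_compact.
move=> y Ky i; pose e : 'rV[R]_n := delta_mx 0 i.
have de (x : 'rV[R]_n) : dotp x e = x ord0 i.
  rewrite /dotp (bigD1 i)//= big1 => [|j ji].
    by rewrite !mxE !eqxx mulr1 addr0.
  by rewrite !mxE (negbTE ji) andbF mulr0.
have bound (x : 'rV[R]_n) : hull_body s r x -> x ord0 i <= B i.
  move=> Kx; rewrite -de; apply: le_trans (Kx e (\sum_(a <- s) `|a ord0 i|) _ _) _.
  - by apply: sumr_ge0.
  - move=> a sa; rewrite de (big_rem a)//= lerDl; exact: sumr_ge0.
  - by rewrite de mxE !eqxx sqrtr1 mulr1 lerD2l ler_norm.
rewrite /= in_itv /= bound// andbT lerNl.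
have := bound _ (hull_body_symmetric Ky); by rewrite mxE.
Qed.

Lemma hull_body_interior s r : 0 < r -> (hull_body s r)° 0.
Proof.
move=> r0; have : open [set y : 'rV[R]_n | dotp y y < r ^+ 2].
  apply: (open_comp (f := fun y => dotp y y) (D := [set u | u < r ^+ 2])).
    have cy : continuous (fun y : 'rV[R]_n => dotp y y).
      by apply: (@continuous_dotp R n _ id id) => w; exact: cvg_id.
    by move=> y _; exact: cy.
  exact: open_lt.
move=> /open_subsetE E; have : [set y : 'rV[R]_n | dotp y y < r ^+ 2] `<=` hull_body s r.
  by move=> y /= /ltW; apply: hull_body_ball; exact: ltW.
by rewrite E; apply; rewrite /= dotp0l exprn_gt0.
Qed.

Lemma hull_body_convex_body s r : 0 < r -> convex_body (hull_body s r).
Proof.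
move=> r0; split; [exact: hull_body_convex|exact: hull_body_compact|].
by exists 0; exact: hull_body_interior.
Qed.

End neighborhood_body.

(** * Calculus of explicitly known integrals *)

Section integral_is.
Context d (T : measurableType d) (R : realType).
Variable mu : {measure set T -> \bar R}.
Implicit Types (f g : T -> R) (a b : R).

(** Bundling the value with measurability and nonnegativity makes such facts closed under sums and
    scaling without side conditions. *)
Definition integral_is f a :=
  [/\ measurable_fun setT f, forall x, 0 <= f x
    & (\int[mu]_x (f x)%:E = a%:E)%E].

Lemma integral_isD f g a b : integral_is f a -> integral_is g b ->
  integral_is (fun x => f x + g x) (a + b).
Proof.
move=> [mf f0 fa] [mg g0 gb]; split.
- exact: measurable_funD.
- by move=> x; rewrite addr_ge0.
under eq_integral do rewrite EFinD.
by rewrite ge0_integralD ?fa ?gb//;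
  [move=> x _; rewrite lee_fin|exact/measurable_EFinP
  |move=> x _; rewrite lee_fin|exact/measurable_EFinP].
Qed.

Lemma integral_isZ f a c : 0 <= c -> integral_is f a ->
  integral_is (fun x => c * f x) (c * a).
Proof.
move=> c0 [mf f0 fa]; split.
- exact: measurable_funM.
- by move=> x; rewrite mulr_ge0.
under eq_integral do rewrite EFinM.
by rewrite ge0_integralZl ?fa//;
  [exact/measurable_EFinP|move=> x _; rewrite lee_fin].
Qed.

Lemma integral_is_sum (I : Type) (s : seq I) (f : I -> T -> R) (a : I -> R) :
  (forall i, integral_is (f i) (a i)) ->
  integral_is (fun x => \sum_(i <- s) f i x) (\sum_(i <- s) a i).
Proof.
move=> fa; elim: s => [|i s IH].
  split.
  - rewrite (_ : (fun _ => _) = cst 0); first exact: measurable_cst.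
    by apply/funext => x; rewrite big_nil.
  - by move=> x; rewrite big_nil.
  - by rewrite big_nil; apply: integral0_eq => x _; rewrite big_nil.
rewrite big_cons; have [h1 h2 h3] := integral_isD (fa i) IH.
have E : (fun x => \sum_(j <- i :: s) f j x) =
    (fun x => f i x + \sum_(j <- s) f j x).
  by apply/funext => x; rewrite big_cons.
by rewrite E.
Qed.

Lemma integral_is_le f g a b : integral_is f a -> integral_is g b ->
  (forall x, f x <= g x) -> a <= b.
Proof.
move=> [mf f0 fa] [mg g0 gb] fg.
rewrite -lee_fin -fa -gb.
by apply: ge0_le_integral_subset => [//|x _|x _|x _]; rewrite lee_fin.
Qed.

Lemma integral_le_is (D : set T) (h : T -> R) f a :
  (forall x, D x -> 0 <= h x) -> integral_is f a ->
  (forall x, D x -> h x <= f x) -> (\int[mu]_(x in D) (h x)%:E <= a%:E)%E.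
Proof.
move=> h0 [mf f0 fa] hf; rewrite -fa.
by apply: ge0_le_integral_subset => [//|x Dx|x _|x Dx]; rewrite lee_fin;
  [exact: h0|exact: f0|exact: hf].
Qed.

Lemma integral_is_ge (D : set T) f g a b : measurable D ->
  integral_is f a -> integral_is g b -> (forall x, ~ D x -> f x <= g x) ->
  ((a - b)%:E <= \int[mu]_(x in D) (f x)%:E)%E.
Proof. by move=> mD [mf f0 fa] [mg g0 gb]; exact: ge0_integral_ge. Qed.

Lemma integral_is_eq f a b : integral_is f a -> a = b -> integral_is f b.
Proof. by move=> + <-. Qed.

Lemma integral_is_fun f g a : integral_is f a -> (forall x, f x = g x) ->
  integral_is g a.
Proof. by move=> + fg; rewrite (_ : g = f)//; apply/funext => x; rewrite fg. Qed.

End integral_is.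

(** * Gaussian masses and Chernoff majorants *)

Section gaussian_is.
Context (R : realType) (n : nat).

Lemma gaussian_is k (a : 'rV[R]_n) : 0 < k ->
  integral_is (@lebesgue_rV R n) (fun x => expR (- k * dotp (x - a) (x - a)))
    (gaussJ k ^+ n).
Proof.
move=> k0; split; [exact: measurable_gaussian| |exact: integral_gaussian].
by move=> x; exact: expR_ge0.
Qed.

Lemma centered_gaussian_is k : 0 < k ->
  integral_is (@lebesgue_rV R n) (fun x => expR (- k * dotp x x))
    (gaussJ k ^+ n).
Proof.
move=> k0; apply: (integral_is_fun (gaussian_is 0 k0)) => x.
by rewrite subr0.
Qed.

Lemma perp_gaussian_is k (xi a : 'rV[R]_n) : 0 < k -> unit_sphere xi ->
  integral_is (lebesgue_perp xi) (fun x => expR (- k * dotp (x - a) (x - a)))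
    (gaussJ k ^+ n.-1 * expR (- k * dotp a xi ^+ 2)).
Proof.
move=> k0 xi1; split; [exact: measurable_gaussian| |].
  by move=> x; exact: expR_ge0.
exact: integral_perp_gaussian.
Qed.

Lemma gaussian_quad_is (b k : R) (v : 'rV[R]_n) : 0 < b -> 0 <= k ->
  integral_is (@lebesgue_rV R n)
    (fun x => expR (- b * dotp x x) * expR (- k * dotp x v ^+ 2))
    (gaussJ b ^+ n / Num.sqrt (1 + k * dotp v v / b)).
Proof.
move=> b0 k0; have h := integral_gaussian_quad 0 v b0 k0.
have E x : expR (- b * dotp x x - k * (dotp x v + 0) ^+ 2) =
    expR (- b * dotp x x) * expR (- k * dotp x v ^+ 2).
  by rewrite addr0 expRD (mulNr k).
split.
- apply: measurable_funM.
    apply: measurableT_comp; first exact: measurable_expR.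
    by apply: measurable_funM => //; exact: measurable_dotp.
  apply: measurableT_comp; first exact: measurable_expR.
  apply: measurable_funM => //; apply: measurable_funX.
  exact: measurable_dotp.
- by move=> x; rewrite mulr_ge0 ?expR_ge0.
under eq_integral do rewrite -E.
by rewrite h expr0n /= mulr0 expR0 mulr1.
Qed.

(* Chernoff bounds: both tails of a Gaussian are dominated pointwise by *)
(* Gaussians of other widths, whose integrals are explicit.             *)
Lemma gaussian_tail_hi (k t : R) (x : 'rV[R]_n) : 0 < k -> t <= dotp x x ->
  expR (- k * dotp x x) <= expR (- (k * t / 2)) * expR (- (2^-1 * k) * dotp x x).
Proof.
move=> k0 tx; rewrite -expRD ler_expR.
have := ler_wpM2l (ltW k0) tx; nra.
Qed.

Lemma gaussian_tail_lo (k t : R) (x : 'rV[R]_n) : 0 < k -> dotp x x <= t ->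
  expR (- k * dotp x x) <= expR (3 * k * t) * expR (- (4 * k) * dotp x x).
Proof.
move=> k0 tx; rewrite -expRD ler_expR.
have := ler_wpM2l (ltW k0) tx; nra.
Qed.

Lemma gaussJ_half (k : R) : 0 < k -> gaussJ (2^-1 * k) = Num.sqrt 2 * gaussJ k.
Proof.
by move=> k0; rewrite gaussJM// ?invr_gt0// sqrtrV// invrK mulrC.
Qed.

Lemma gaussJ_quad (k : R) : 0 < k -> gaussJ (4 * k) = gaussJ k / 2.
Proof.
move=> k0; rewrite gaussJM//; congr (_ / _).
by rewrite (_ : 4 = 2 ^+ 2) ?sqrtr_sqr ?ger0_norm//; ring.
Qed.

End gaussian_is.

(** * Numerical bounds for the tails *)

Section numeric_tails.
Context (R : realType).

Lemma sqrt2_le : Num.sqrt 2 <= 36 / 25 :> R.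
Proof. by rewrite -(@ger0_norm R (36/25))// -sqrtr_sqr ler_wsqrtr//; lra. Qed.

Lemma expRN1_le : expR (-1) <= 5 / 12 :> R.
Proof.
have h : (5 / 4) ^+ 4 <= expR 1 :> R.
  rewrite (_ : 1 = 4^-1 * 4%:R :> R); last by field.
  rewrite expRM_natr ler_pXn2r ?nnegrE ?expR_ge0//; try lra.
  by have := expR_ge1Dx (4^-1 : R); lra.
rewrite expRN -[leRHS]invrK lef_pV2 ?posrE ?expR_gt0 ?invr_gt0//; try lra.
Qed.

(** sqrt 2 / e <= 36/25 x 5/12 = 3/5, and (3/5)^3 < 1/4. *)
Lemma tail_hi_le m : (3 <= m)%N -> expR (- m%:R) * Num.sqrt 2 ^+ m <= 1 / 4 :> R.
Proof.
move=> m3; rewrite -[- _]mulr1 mulNr -mulrN expRM_natl -exprMn.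
have h0 : 0 <= expR (-1) * Num.sqrt 2 :> R.
  by rewrite mulr_ge0 ?expR_ge0 ?sqrtr_ge0.
have h : expR (-1) * Num.sqrt 2 <= 3 / 5 :> R.
  have := expRN1_le; have := sqrt2_le; have := expR_ge0 (-1 : R).
  have := @sqrtr_ge0 R 2; nra.
apply: (@le_trans _ _ ((3 / 5) ^+ m)).
  by rewrite ler_pXn2r ?nnegrE//; case: m m3.
rewrite -(subnK m3) exprD.
have : (3 / 5) ^+ (m - 3) <= 1 :> R by apply: exprn_ile1; lra.
have : 0 <= (3 / 5) ^+ (m - 3) :> R by apply: exprn_ge0; lra.
nra.
Qed.

(** e^{1/4} / 2 <= 2/3, and (2/3)^6 < 1/8. *)
Lemma tail_lo_le m : (6 <= m)%N -> expR (m%:R / 4) / 2 ^+ m <= 1 / 8 :> R.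
Proof.
move=> m6; rewrite expRM_natl -expr_div_n.
have h : expR (4^-1) / 2 <= 2 / 3 :> R.
  have := expR_ge1Dx (- 4^-1 : R); rewrite expRN.
  have := expR_gt0 (4^-1 : R) => e0 h.
  have : (1 - 4^-1) * expR 4^-1 <= 1 :> R by rewrite -ler_pdivlMr// div1r.
  lra.
have h0 : 0 <= expR (4^-1) / 2 :> R by rewrite divr_ge0 ?expR_ge0.
apply: (@le_trans _ _ ((2 / 3) ^+ m)).
  by rewrite ler_pXn2r ?nnegrE//; case: m m6.
rewrite -(subnK m6) exprD.
have : (2 / 3) ^+ (m - 6) <= 1 :> R by apply: exprn_ile1; lra.
have : 0 <= (2 / 3) ^+ (m - 6) :> R by apply: exprn_ge0; lra.
nra.
Qed.

End numeric_tails.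

(** * Points avoiding all central slabs *)

Section spread_points.
Context (R : realType) (n : nat).
Hypothesis n6 : (6 <= n)%N.
Variables (b k : R).
Hypotheses (b0 : 0 < b) (k0 : 0 < k).

(** A shell around the mean n / (2b) of |x|^2 under the density proportional to e^{-b|x|^2}; at most
    1/4 + 1/8 of the mass lies outside. *)
Definition in_shell (x : 'rV[R]_n) :=
  n%:R / 12 / b <= dotp x x <= 2 * n%:R / b.

(** For a unit [v], the damping factor of a bump at [x] on the hyperplane orthogonal to [v]: a
    smooth indicator of a central slab of width about 1 / sqrt k. *)
Definition slab (v x : 'rV[R]_n) : R := expR (- k * dotp x v ^+ 2).

Let rate := 4 * Num.sqrt (b / k).

Let rate_gt0 : 0 < rate.
Proof. by rewrite mulr_gt0// sqrtr_gt0 divr_gt0. Qed.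

(** The left side is the Gaussian mean of [slab v], by [gaussian_quad_is]. Bounding it by half of
    [rate] leaves room for the mass outside the shell. *)
Lemma slab_mean_le (v : 'rV[R]_n) : 1 / 4 <= dotp v v ->
  (Num.sqrt (1 + k * dotp v v / b))^-1 <= rate / 2.
Proof.
move=> v4; rewrite -sqrtrV; last first.
  by rewrite addr_ge0// divr_ge0 ?(ltW b0)// mulr_ge0 ?(ltW k0)// dotp_ge0.
have -> : rate / 2 = Num.sqrt (4 * (b / k)).
  have s4 : Num.sqrt 4 = 2 :> R.
    by rewrite (_ : 4 = 2 ^+ 2) ?sqrtr_sqr ?ger0_norm//; ring.
  by rewrite (sqrtrM (b / k)) ?s4// /rate; field.
apply: ler_wsqrtr; rewrite -[leRHS]invrK lef_pV2; last 2 first.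
- by rewrite posrE ltr_pwDl// divr_ge0 ?(ltW b0)// mulr_ge0 ?(ltW k0)// dotp_ge0.
- by rewrite posrE invr_gt0 mulr_gt0// divr_gt0.
have -> : (4 * (b / k))^-1 = k * (1 / 4) / b by field; rewrite !gt_eqF.
rewrite -[leLHS]add0r lerD// ler_wpM2r ?invr_ge0 ?(ltW b0)//.
by rewrite ler_wpM2l// ltW.
Qed.

(** First-moment argument. If the weighted sum exceeded [rate] times the total weight throughout the
    shell, integrating against e^{-b|x|^2} would give 1 <= 1/2 + 3/8: the slab means contribute 1/2
    and the two tails 3/8. *)
Lemma spread_point (I : finType) (P : pred I) (w : I -> R) (v : I -> 'rV[R]_n) :
  (forall i, 0 <= w i) -> 0 < \sum_(i | P i) w i ->
  (forall i, P i -> 1 / 4 <= dotp (v i) (v i)) ->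
  exists x, in_shell x /\
    \sum_(i | P i) w i * slab (v i) x <= rate * \sum_(i | P i) w i.
Proof.
move=> w0 W0 v4; apply: contrapT => noX.
set W := \sum_(i | P i) w i in W0 noX.
have rW0 : 0 < rate * W by rewrite mulr_gt0.
have J0 := gaussJ_gt0 b0.
pose s := [seq i <- enum I | P i].
have sumE F : \sum_(i <- s) F i = \sum_(i | P i) F i :> R.
  by rewrite big_filter big_enum_cond.
pose lhs (x : 'rV[R]_n) := rate * W * expR (- b * dotp x x).
have lhs_is : integral_is (@lebesgue_rV R n) lhs (rate * W * gaussJ b ^+ n).
  by apply: integral_isZ; [exact: ltW|exact: centered_gaussian_is].
pose sum_is := integral_is_sum s (fun i => integral_isZ (w0 i)
  (gaussian_quad_is (v i) b0 (ltW k0))).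
have h2 : 0 < 2^-1 * b by rewrite mulr_gt0.
have h4 : 0 < 4 * b by rewrite mulr_gt0.
have hi_is := integral_isZ (expR_ge0 (- n%:R)) (@centered_gaussian_is R n _ h2).
have lo_is := integral_isZ (expR_ge0 (n%:R / 4)) (@centered_gaussian_is R n _ h4).
have rhs_is := integral_isD sum_is (integral_isZ (ltW rW0) (integral_isD hi_is lo_is)).
have : rate * W * gaussJ b ^+ n <= _ := integral_is_le lhs_is rhs_is _.
rewrite gaussJ_half// gaussJ_quad// expr_div_n exprMn.
set Jn := gaussJ b ^+ n.
have Jn0 : 0 < Jn by rewrite exprn_gt0.
have Sle : \sum_(i <- s) w i * (Jn / Num.sqrt (1 + k * dotp (v i) (v i) / b)) <=
    W * (rate / 2) * Jn.
  rewrite sumE /W -mulrA mulr_suml; apply: ler_sum => i Pi.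
  by rewrite ler_wpM2l// mulrC ler_wpM2r// ?(ltW Jn0)// slab_mean_le// v4.
have hi := @tail_hi_le R n (leq_trans (isT : 3 <= 6)%N n6).
have lo := @tail_lo_le R n n6.
have T : expR (- n%:R) * (Num.sqrt 2 ^+ n * Jn) + expR (n%:R / 4) * (Jn / 2 ^+ n)
    <= 3 / 8 * Jn.
  rewrite (_ : _ + _ = (expR (- n%:R) * Num.sqrt 2 ^+ n +
    expR (n%:R / 4) / 2 ^+ n) * Jn); last by ring.
  by rewrite ler_wpM2r// ?(ltW Jn0)//; lra.
have {}T := ler_wpM2l (ltW rW0) T.
have P0 : 0 < rate * W * Jn by rewrite mulr_gt0.
move=> H; have {}H := H _.
suff : ~ (rate * W * Jn <= \sum_(i <- s) w i * (Jn / Num.sqrt (1 + k * dotp (v i) (v i) / b)) +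
   rate * W * (expR (- n%:R) * (Num.sqrt 2 ^+ n * Jn) + expR (n%:R / 4) * (Jn / 2 ^+ n))).
  apply; apply: H => x; rewrite /lhs.
  have S0 : 0 <= \sum_(i <- s) w i * (expR (- b * dotp x x) * expR (- k * dotp x (v i) ^+ 2)).
    by apply: sumr_ge0 => i _; rewrite mulr_ge0// mulr_ge0// expR_ge0.
  have [xhi|xhi] := leP (2 * n%:R / b) (dotp x x).
    apply: le_trans (ler_wpM2l (ltW rW0) (gaussian_tail_hi b0 xhi)) _.
    rewrite (_ : - (b * _ / 2) = - n%:R); last by field; rewrite gt_eqF.
    by rewrite mulrDr addrCA lerDl addr_ge0// mulr_ge0 ?(ltW rW0)// mulr_ge0 ?expR_ge0.
  have [xlo|xlo] := leP (dotp x x) (n%:R / 12 / b).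
    apply: le_trans (ler_wpM2l (ltW rW0) (gaussian_tail_lo b0 xlo)) _.
    rewrite (_ : 3 * b * _ = n%:R / 4); last by field; rewrite gt_eqF.
    by rewrite mulrDr addrA lerDr addr_ge0// mulr_ge0 ?(ltW rW0)// mulr_ge0 ?expR_ge0.
  have xS : rate * W <= \sum_(i <- s) w i * slab (v i) x.
    rewrite leNgt; apply/negP => xS; apply: noX; exists x; split.
      by rewrite /in_shell !ltW.
    by rewrite -sumE ltW.
  have -> : \sum_(i <- s) w i * (expR (- b * dotp x x) * expR (- k * dotp x (v i) ^+ 2)) =
      (\sum_(i <- s) w i * slab (v i) x) * expR (- b * dotp x x).
    by rewrite mulr_suml; apply: eq_bigr => i _; rewrite /slab; ring.
  apply: le_trans (ler_wpM2r (expR_ge0 _) xS) _.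
  by rewrite lerDl mulr_ge0 ?(ltW rW0)// addr_ge0// mulr_ge0 ?expR_ge0.
move=> {}H; have := le_trans H (lerD Sle T); lra.
Qed.

(* The method of conditional expectations: the points are chosen one at a   *)
(* time, keeping the potential sum_i prod_x (1 + slab (v i) x) from growing *)
(* faster than on average.                                                  *)
Lemma spread_points (I : finType) (P : pred I) (v : I -> 'rV[R]_n) (N : nat) :
  (exists i, P i) -> (forall i, P i -> 1 / 4 <= dotp (v i) (v i)) ->
  exists s : seq 'rV[R]_n, [/\ size s = N, forall x, x \in s -> in_shell x
    & forall i, P i ->
      \sum_(x <- s) slab (v i) x <= 2 * (ln #|I|%:R + N%:R * rate)].
Proof.
move=> [i0 Pi0] v4.
have slab0 i x : 0 <= slab (v i) x by exact: expR_ge0.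
have slab1 i x : slab (v i) x <= 1.
  by rewrite /slab expR_le1 mulNr oppr_le0 mulr_ge0 ?(ltW k0)// sqr_ge0.
have I0 : 0 < #|I|%:R :> R by rewrite ltr0n; apply/card_gt0P; exists i0.
suff [s [sN ss sP]] : exists s : seq 'rV[R]_n, [/\ size s = N,
    forall x, x \in s -> in_shell x
    & \sum_(i | P i) \prod_(x <- s) (1 + slab (v i) x) <=
      #|I|%:R * (1 + rate) ^+ N].
  exists s; split => // i Pi.
  have pr0 j : 0 <= \prod_(x <- s) (1 + slab (v j) x).
    by apply: prodr_ge0 => x _; rewrite addr_ge0.
  have : \prod_(x <- s) (1 + slab (v i) x) <= #|I|%:R * (1 + rate) ^+ N.
    by apply: le_trans sP; rewrite (bigD1 i)//= lerDl sumr_ge0.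
  (* For t in [0,1], e^{t/2} <= 1 / (1 - t/2) <= 1 + t; this turns the bound on the product into a
     bound on the sum. *)
  have : expR (\sum_(x <- s) slab (v i) x / 2) <= \prod_(x <- s) (1 + slab (v i) x).
    rewrite expR_sum; apply: ler_prod => x _; rewrite expR_ge0/=.
    have := slab0 i x; have := slab1 i x; set t := slab _ _ => t1 t0.
    have := expR_ge1Dx (- (t / 2)); rewrite expRN => h.
    have e0 := expR_gt0 (t / 2).
    have {}h : (1 - t / 2) * expR (t / 2) <= 1 by rewrite -ler_pdivlMr// div1r.
    nra.
  move=> /le_trans /[apply] h.
  have {}h : expR (\sum_(x <- s) slab (v i) x / 2) <= expR (ln #|I|%:R + N%:R * rate).
    apply: le_trans h _; rewrite expRD lnK ?posrE// ler_wpM2l ?(ltW I0)//.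
    rewrite expRM_natl; apply: lerXn2r; rewrite ?nnegrE ?expR_ge0//.
      by rewrite addr_ge0// ltW.
    exact: expR_ge1Dx.
  by move: h; rewrite ler_expR -mulr_suml; lra.
elim: N => [|N [s [sN ss sP]]].
  exists [::]; split => //; rewrite expr0 mulr1.
  under eq_bigr do rewrite big_nil.
  by rewrite sumr_const ler_nat max_card.
pose w i := \prod_(x <- s) (1 + slab (v i) x).
have w0 i : 0 < w i.
  by apply: prodr_gt0 => x _; rewrite ltr_pwDl.
have W0 : 0 < \sum_(i | P i) w i.
  rewrite (bigD1 i0)//= ltr_pwDl// sumr_ge0// => i _; exact: ltW.
have [x [xsh xP]] := spread_point (fun i => ltW (w0 i)) W0 v4.
exists (x :: s); split => [|y|].
- by rewrite /= sN.
- by rewrite inE => /orP[/eqP ->|/ss].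
under eq_bigr do rewrite big_cons mulrDl mul1r mulrC.
rewrite big_split /= exprS mulrCA mulrDl mul1r.
by apply: lerD => //; apply: le_trans xP _; rewrite ler_wpM2l// ltW.
Qed.

End spread_points.

(** * The density and the measures of the two bodies *)

Section bump_density.
Context (R : realType) (n : nat).
Variables (A k : R) (s : seq 'rV[R]_n).
Hypotheses (A0 : 0 <= A) (k0 : 0 < k).

Definition bump (a x : 'rV[R]_n) : R := expR (- k * dotp (x - a) (x - a)).

Definition bump_density (x : 'rV[R]_n) : R :=
  expR (- 1 * dotp x x) + A * \sum_(a <- s) (bump a x + bump (- a) x).

Let bump_ge0 a x : 0 <= bump a x. Proof. exact: expR_ge0. Qed.

Lemma bump_density_gt0 x : 0 < bump_density x.
Proof.
rewrite ltr_pwDl ?expR_gt0// mulr_ge0// sumr_ge0// => a _.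
by rewrite addr_ge0.
Qed.

Lemma bump_density_even x : bump_density (- x) = bump_density x.
Proof.
have E (a y : 'rV[R]_n) : bump a (- y) = bump (- a) y.
  by rewrite /bump -dotpNN opprD opprK opprK.
rewrite /bump_density dotpNN; congr (_ + _ * _).
by apply: eq_bigr => a _; rewrite !E opprK addrC.
Qed.

Lemma continuous_gaussian c (a : 'rV[R]_n) :
  continuous (fun x : 'rV[R]_n => expR (- c * dotp (x - a) (x - a))).
Proof.
have cxx : continuous (fun x : 'rV[R]_n => dotp x x).
  by apply: (@continuous_dotp R n _ id id) => x; exact: cvg_id.
have cxa : continuous (fun x : 'rV[R]_n => dotp x a).
  apply: (@continuous_dotp R n _ id (fun _ => a)) => x; first exact: cvg_id.
  exact: (@cvg_cst _ a _ (nbhs x) _).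
have cr (r : R) : continuous (fun _ : 'rV[R]_n => r).
  by move=> x; exact: (@cvg_cst _ r _ (nbhs x) _).
rewrite (_ : (fun _ => _) = fun x =>
  expR (- c * (dotp x x - 2 * dotp x a + dotp a a))); last first.
  by apply/funext => x; rewrite dotp_sqrB.
move=> x; apply: (@continuous_comp _ _ _
  (fun x : 'rV[R]_n => - c * (dotp x x - 2 * dotp x a + dotp a a)) expR).
  apply: (@continuousM _ _ (fun _ => - c)); first exact: cr.
  apply: (@continuousD _ R _ (fun x => dotp x x - 2 * dotp x a)
    (fun _ => dotp a a)); last exact: cr.
  apply: (@continuousB _ R _ (fun x => dotp x x)
    (fun x => 2 * dotp x a)); first exact: cxx.
  by apply: (@continuousM _ _ (fun _ => 2)); [exact: cr|exact: cxa].
exact: continuous_expR.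
Qed.

Lemma continuous_bump_density : continuous bump_density.
Proof.
have cs : continuous (fun x => \sum_(a <- s) (bump a x + bump (- a) x)).
  apply: continuous_sumr => a x.
  apply: (@continuousD _ R _ (bump a) (bump (- a)));
    exact: continuous_gaussian.
have cr (r : R) : continuous (fun _ : 'rV[R]_n => r).
  by move=> x; exact: (@cvg_cst _ r _ (nbhs x) _).
move=> x; apply: (@continuousD _ R _ (fun x => expR (- 1 * dotp x x))
  (fun x => A * \sum_(a <- s) (bump a x + bump (- a) x))).
  have := @continuous_gaussian 1 0 x.
  by rewrite (_ : (fun _ => _) = (fun y => expR (- 1 * dotp y y)))//;
    apply/funext => y; rewrite subr0.
by apply: (@continuousM _ _ (fun _ => A)); [exact: cr|exact: cs].
Qed.

Lemma bump_density_ge_gaussian x : expR (- 1 * dotp x x) <= bump_density x.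
Proof. by rewrite lerDl mulr_ge0// sumr_ge0// => a _; rewrite addr_ge0. Qed.

Lemma perp_bump_is (xi a : 'rV[R]_n) : unit_sphere xi ->
  integral_is (lebesgue_perp xi) (fun x => bump a x + bump (- a) x)
    (gaussJ k ^+ n.-1 * (2 * expR (- k * dotp a xi ^+ 2))).
Proof.
move=> xi1; apply: integral_is_eq
  (integral_isD (perp_gaussian_is a k0 xi1) (perp_gaussian_is (- a) k0 xi1)) _.
by rewrite dotpNl sqrrN; ring.
Qed.

(* A point x of the body satisfies |x|^2 <= max_a |<a,x>| + r |x|, so it is *)
(* short or lies in one of the half-spaces |<a,x>| > T.                     *)
Lemma mu_section_hull_le (r t T lam M : R) (xi : 'rV[R]_n) :
  unit_sphere xi -> 0 <= T -> 0 <= lam ->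
  (forall u, 0 <= u -> t < u ^+ 2 -> T + r * u < u ^+ 2) ->
  (forall a, a \in s -> dotp a a <= M) ->
  (mu_section bump_density (hull_body s r) xi <=
   (gaussJ 1 ^+ n.-1 * (expR (3 * t) / 2 ^+ n.-1 +
      2 * (size s)%:R * expR (lam ^+ 2 * M - 2 * lam * T)) +
    A * (gaussJ k ^+ n.-1 *
      (2 * \sum_(a <- s) expR (- k * dotp a xi ^+ 2))))%:E)%E.
Proof.
move=> xi1 T0 lam0 tT sM; have J0 := @gaussJ_gt0 R 1 ltr01.
have h4 : 0 < 4 * 1 :> R by rewrite mulr1.
pose E c (a x : 'rV[R]_n) : R := expR (- c * dotp (x - a) (x - a)).
pose C (a : 'rV[R]_n) := expR (lam ^+ 2 * dotp a a - 2 * lam * T).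
have lo_is : integral_is _ _ _ :=
  integral_isZ (expR_ge0 (3 * 1 * t)) (perp_gaussian_is 0 h4 xi1).
have half_is : integral_is _ _ _ := integral_is_sum s (fun a =>
  integral_isZ (expR_ge0 (lam ^+ 2 * dotp a a - 2 * lam * T))
   (integral_isD (perp_gaussian_is (lam *: a) ltr01 xi1)
                 (perp_gaussian_is (- (lam *: a)) ltr01 xi1))).
have bump_is : integral_is _ _ _ := integral_isZ A0
  (integral_is_sum s (fun a => perp_bump_is a xi1)).
apply: le_trans (integral_le_is _
  (integral_isD (integral_isD lo_is half_is) bump_is) _) _.
- by move=> x _; rewrite ltW// bump_density_gt0.
- move=> x [Kx xperp]; rewrite lerD2r subr0.
  have S0 a y : 0 <= C a * (E 1 (lam *: a) y + E 1 (- (lam *: a)) y).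
    by rewrite mulr_ge0 ?expR_ge0// addr_ge0 ?expR_ge0.
  have [xt|xt] := leP (dotp x x) t.
    apply: le_trans (gaussian_tail_lo ltr01 xt) _.
    by rewrite lerDl sumr_ge0// => a _; exact: S0.
  have [a sa aT] : exists2 a, a \in s & T < `|dotp a x|.
    apply: contrapT => noa; have /Kx : forall a, a \in s -> `|dotp a x| <= T.
      by move=> a sa; rewrite leNgt; apply/negP => aT; apply: noa; exists a.
    move=> /(_ T0); rewrite leNgt => /negP; apply.
    rewrite -[ltRHS]sqr_sqrtr ?dotp_ge0//; apply: tT; first exact: sqrtr_ge0.
    by rewrite sqr_sqrtr// dotp_ge0.
  rewrite -[leLHS]add0r; apply: lerD; first by rewrite mulr_ge0 ?expR_ge0.
  rewrite (big_rem a)//= -[leLHS]addr0; apply: lerD; last first.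
    by apply: sumr_ge0 => b _; exact: S0.
  (* Exponential tilting: on this half-space the central Gaussian is dominated by a small multiple
     of the Gaussian centred at e. *)
  have key (e : 'rV[R]_n) : lam * T <= dotp x e -> dotp e e = lam ^+ 2 * dotp a a ->
      expR (- 1 * dotp x x) <= C a * E 1 e x.
    move=> he ee; rewrite /C /E -expRD ler_expR dotp_sqrB ee; lra.
  have [ax|ax] := leP 0 (dotp a x).
    rewrite ger0_norm// in aT.
    apply: le_trans (key (lam *: a) _ _) _.
    + by rewrite dotpZr ler_wpM2l// dotpC ltW.
    + by rewrite dotpZl dotpZr; ring.
    + by rewrite mulrDr lerDl mulr_ge0 ?expR_ge0.
  rewrite ltr0_norm// in aT.
  apply: le_trans (key (- (lam *: a)) _ _) _.
  + by rewrite dotpNr dotpZr -mulrN ler_wpM2l// dotpC ltW.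
  + by rewrite dotpNN dotpZl dotpZr; ring.
  + by rewrite mulrDr lerDr mulr_ge0 ?expR_ge0.
rewrite lee_fin; apply: lerD; last first.
  rewrite le_eqVlt; apply/orP; left; apply/eqP; congr (_ * _).
  by rewrite !mulr_sumr.
rewrite mulrDr; apply: lerD.
  rewrite gaussJ_quad// dotp0l expr0n /= mulr0 expR0 mulr1 expr_div_n mulr1.
  by rewrite le_eqVlt; apply/orP; left; apply/eqP; ring.
have -> : 2 * (size s)%:R * expR (lam ^+ 2 * M - 2 * lam * T) =
    \sum_(a <- s) 2 * expR (lam ^+ 2 * M - 2 * lam * T).
  by rewrite big_const_seq count_predT iter_addr_0 -mulr_natr; ring.
rewrite mulr_sumr big_seq [leRHS]big_seq; apply: ler_sum => a sa.
rewrite -mulrDr mulrCA ler_wpM2l ?exprn_ge0 ?(ltW J0)// mulrC.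
apply: ler_pM; rewrite ?expR_ge0 ?addr_ge0 ?expR_ge0//.
  have e1 z : expR (- 1 * z ^+ 2) <= 1 :> R.
    by rewrite expR_le1 mulN1r oppr_le0 sqr_ge0.
  by have := lerD (e1 (dotp (lam *: a) xi)) (e1 (dotp (- (lam *: a)) xi)).
by rewrite ler_expR lerD2r ler_wpM2l ?sqr_ge0// sM.
Qed.

(** The body contains the ball of radius r around each centre a, which catches most of the bump
    there. Only the bumps at +a are counted. *)
Lemma mu_density_hull_ge (r : R) : 0 <= r ->
  ((A * ((size s)%:R * (gaussJ k ^+ n *
     (1 - expR (- (k * r ^+ 2 / 2)) * Num.sqrt 2 ^+ n))))%:E <=
   mu_density bump_density (hull_body s r))%E.
Proof.
move=> r0; pose D (a : 'rV[R]_n) := [set x : 'rV[R]_n | dotp (x - a) (x - a) <= r ^+ 2].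
pose U := \bigcup_(a in [set` s]) D a.
have mU : measurable U.
  apply: fin_bigcup_measurable; first exact: finite_seq.
  by move=> a _; exact: measurable_ball.
have h2 : 0 < 2^-1 * k by rewrite mulr_gt0.
have f_is : integral_is _ _ _ := integral_isZ A0
  (integral_is_sum s (fun a => gaussian_is a k0)).
have g_is : integral_is _ _ _ := integral_isZ A0 (integral_is_sum s (fun a =>
  integral_isZ (expR_ge0 (- (k * r ^+ 2 / 2))) (gaussian_is a h2))).
have sumc c : \sum_(a <- s) c = (size s)%:R * c :> R.
  by rewrite big_const_seq count_predT iter_addr_0 mulr_natl.
apply: (@le_trans _ _ (\int[@lebesgue_rV R n]_(x in U)
    (A * \sum_(a <- s) expR (- k * dotp (x - a) (x - a)))%:E)%E).
  apply: le_trans (integral_is_ge mU f_is g_is _).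
    rewrite lee_fin !sumc gaussJ_half// exprMn le_eqVlt; apply/orP; left.
    by apply/eqP; ring.
  move=> x Ux; rewrite ler_wpM2l// big_seq [leRHS]big_seq; apply: ler_sum => a sa.
  apply: gaussian_tail_hi => //.
  by rewrite leNgt; apply/negP => xr; apply: Ux; exists a => //=; exact: ltW.
apply: ge0_le_integral_subset.
- by move=> x [a /= sa xa]; exact: hull_body_near xa.
- by move=> x _; rewrite lee_fin mulr_ge0// sumr_ge0// => a _; rewrite expR_ge0.
- by move=> x _; rewrite lee_fin ltW// bump_density_gt0.
move=> x _; rewrite lee_fin -[leLHS]add0r lerD ?expR_ge0// ler_wpM2l//.
by apply: ler_sum => a _; rewrite lerDl.
Qed.

Lemma mu_density_ball_ge (l : R) : 0 <= l ->
  ((gaussJ 1 ^+ n * (1 - expR (- (l ^+ 2 / 2)) * Num.sqrt 2 ^+ n))%:E <=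
   mu_density bump_density (hull_body [::] l))%E.
Proof.
move=> l0; have h2 : 0 < 2^-1 * 1 :> R by rewrite mulr1.
pose D := [set x : 'rV[R]_n | dotp (x - 0) (x - 0) <= l ^+ 2].
have := integral_is_ge (measurable_ball (l ^+ 2) 0)
  (@centered_gaussian_is R n 1 ltr01)
  (integral_isZ (expR_ge0 (- (1 * l ^+ 2 / 2))) (@centered_gaussian_is R n _ h2)).
rewrite gaussJ_half// exprMn mul1r -/D => H.
apply: le_trans (le_trans (H _) _).
- by rewrite lee_fin le_eqVlt; apply/orP; left; apply/eqP; ring.
- move=> x; rewrite /D /= subr0 => /negP; rewrite -ltNge => /ltW xl.
  by have := gaussian_tail_hi ltr01 xl; rewrite mul1r.
apply: ge0_le_integral_subset => [x|x _|x _|x _].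
- by rewrite /D /= subr0 => xl; apply/hull_body_nilP.
- by rewrite lee_fin expR_ge0.
- by rewrite lee_fin ltW// bump_density_gt0.
- by rewrite lee_fin bump_density_ge_gaussian.
Qed.

(** The frame is an isometry, so the section pulls back to the ball of the same radius in dimension
    n - 1. *)
Lemma mu_section_ball_ge (l : R) (xi : 'rV[R]_n) : 0 <= l -> unit_sphere xi ->
  ((gaussJ 1 ^+ n.-1 * (1 - expR (- (l ^+ 2 / 2)) * Num.sqrt 2 ^+ n.-1))%:E <=
   mu_section bump_density (hull_body [::] l) xi)%E.
Proof.
move=> l0 xi1; have h2 : 0 < 2^-1 * 1 :> R by rewrite mulr1.
set U := get (perp_frame xi); have UP : perp_frame xi U := perp_frameP xi1.
pose B := [set x : 'rV[R]_n | dotp (x - 0) (x - 0) <= l ^+ 2].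
have mB : measurable B := measurable_ball (l ^+ 2) 0.
have mperp : measurable (perp xi).
  have m : measurable_fun setT (fun x : 'rV[R]_n => dotp x xi).
    exact: measurable_dotp.
  by have := m measurableT _ (measurable_set1 0); rewrite setTI.
have UU y : dotp (y *m U) (y *m U) = dotp y y.
  have := dotp_subU 0 y xi1 UP.
  by rewrite !subr0 mul0mx subr0 dotp0l expr0n addr0.
pose D := [set y : 'rV[R]_n.-1 | dotp (y - 0) (y - 0) <= l ^+ 2].
have mD : measurable D := measurable_ball (l ^+ 2) 0.
have H := integral_is_ge mD
  (@centered_gaussian_is R n.-1 1 ltr01)
  (integral_isZ (expR_ge0 (- (1 * l ^+ 2 / 2))) (@centered_gaussian_is R n.-1 _ h2)).
rewrite gaussJ_half// exprMn mul1r in H.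
have mg : measurable_fun setT (fun x : 'rV[R]_n => (expR (- 1 * dotp x x))%:E).
  by apply/measurable_EFinP; have [] := @centered_gaussian_is R n 1 ltr01.
apply: (@le_trans _ _ (\int[lebesgue_perp xi]_(x in B `&` perp xi)
    (expR (- 1 * dotp x x))%:E)%E).
  rewrite integral_perp; last 3 first.
  - exact: measurableI.
  - exact: measurable_funS mg.
  - by move=> x; rewrite lee_fin expR_ge0.
  rewrite -/U (_ : _ @^-1` _ = D); last first.
    apply/seteqP; split => y; rewrite /B /D /= !subr0 UU; first by case.
    by move=> yl; split => //; exact: perp_frame_perp UP.
  under eq_integral do rewrite UU.
  apply: le_trans (H _).
    by rewrite lee_fin le_eqVlt; apply/orP; left; apply/eqP; ring.
  move=> x; rewrite /D /= subr0 => /negP; rewrite -ltNge => /ltW xl.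
  by have := gaussian_tail_hi ltr01 xl; rewrite mul1r.
apply: ge0_le_integral_subset => [x [xl xp]|x _|x _|x _].
- by split => //; apply/hull_body_nilP => //; move: xl; rewrite /B /= subr0.
- by rewrite lee_fin expR_ge0.
- by rewrite lee_fin ltW// bump_density_gt0.
- by rewrite lee_fin bump_density_ge_gaussian.
Qed.

(** Each point of the ball is at squared distance at least t from every centre, so only bump tails
    add to the full Gaussian mass. *)
Lemma mu_density_ball_le (l t : R) : 0 <= l ->
  (forall a, a \in s -> t <= dotp a a / 2 - l ^+ 2) ->
  (mu_density bump_density (hull_body [::] l) <=
   (gaussJ 1 ^+ n + A * ((size s)%:R * (2 * (expR (- (k * t / 2)) *
     (Num.sqrt 2 ^+ n * gaussJ k ^+ n)))))%:E)%E.
Proof.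
move=> l0 st; have h2 : 0 < 2^-1 * k by rewrite mulr_gt0.
have g_is : integral_is _ _ _ := integral_isZ A0 (integral_is_sum s (fun a =>
  integral_isZ (expR_ge0 (- (k * t / 2)))
    (integral_isD (gaussian_is a h2) (gaussian_is (- a) h2)))).
have sumc c : \sum_(a <- s) c = (size s)%:R * c :> R.
  by rewrite big_const_seq count_predT iter_addr_0 mulr_natl.
apply: le_trans (integral_le_is _
  (integral_isD (@centered_gaussian_is R n 1 ltr01) g_is) _) _.
- by move=> x _; rewrite ltW// bump_density_gt0.
- move=> x /hull_body_nilP => /(_ l0) xl.
  rewrite lerD2l ler_wpM2l// big_seq [leRHS]big_seq; apply: ler_sum => a sa.
  have key (b : 'rV[R]_n) : dotp b b = dotp a a ->
      bump b x <= expR (- (k * t / 2)) * expR (- (2^-1 * k) * dotp (x - b) (x - b)).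
    move=> ba; apply: gaussian_tail_hi => //.
    by apply: le_trans (dotp_sqrB_ge x b); rewrite ba; have := st a sa; lra.
  by rewrite mulrDr; apply: lerD; apply: key; rewrite ?dotpNN.
rewrite lee_fin sumc gaussJ_half// exprMn le_eqVlt; apply/orP; left; apply/eqP.
by ring.
Qed.

End bump_density.

(** * A net of directions and the choice of the centres *)

Section point_set.
Context (R : realType).

Definition grid_point n M (g : {ffun 'I_n -> 'I_(2 * M).+1}) : 'rV[R]_n :=
  \row_i ((g i)%:R / M%:R - 1).

Lemma grid_net n M (xi : 'rV[R]_n) : (0 < M)%N -> unit_sphere xi ->
  exists g : {ffun 'I_n -> 'I_(2 * M).+1},
    dotp (xi - grid_point g) (xi - grid_point g) <= n%:R / M%:R ^+ 2.
Proof.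
move=> M0 /unit_sphere_dotp xi1.
have MR0 : 0 < M%:R :> R by rewrite ltr0n.
pose t i := (xi ord0 i + 1) * M%:R.
have xi_i i : -1 <= xi ord0 i <= 1.
  rewrite -ler_norml -(@ler_pXn2r _ 2) ?nnegrE// expr1n real_normK ?num_real//.
  by rewrite -xi1 coord_sqr_le_dotp.
have t0 i : 0 <= t i.
  by have /andP[h _] := xi_i i; rewrite mulr_ge0 ?(ltW MR0)//; lra.
have tM i : (Num.trunc (t i) < (2 * M).+1)%N.
  rewrite ltnS truncn_le_nat; have /andP[_ h] := xi_i i.
  apply: (@le_lt_trans _ _ (2 * M)%:R); last by rewrite ltr_nat.
  by rewrite natrM ler_wpM2r ?(ltW MR0)//; lra.
exists [ffun i => Ordinal (tM i)].
have -> : n%:R / M%:R ^+ 2 = \sum_(i < n) (M%:R ^+ 2)^-1 :> R.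
  by rewrite sumr_const card_ord mulr_natl.
apply: ler_sum => i _; rewrite !mxE ffunE /= -expr2 -exprVn.
have /andP[h1 h2] := truncn_itv (t0 i).
rewrite -real_normK ?num_real//; apply: lerXn2r; rewrite ?nnegrE ?invr_ge0 ?(ltW MR0)//.
have -> : xi ord0 i - ((Num.trunc (t i))%:R / M%:R - 1) =
    (t i - (Num.trunc (t i))%:R) / M%:R by rewrite /t; field; rewrite gt_eqF.
rewrite normrM normfV (ger0_norm (ltW MR0)) ler_piMl ?invr_ge0 ?(ltW MR0)//.
rewrite ger0_norm ?subr_ge0// lerBlDl natr1; exact: ltW.
Qed.

Lemma ln_ge_half n : (3 <= n)%N -> 1 / 2 <= ln n%:R :> R.
Proof.
move=> n3; have e0 := expR_gt0 (1 / 2 : R).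
rewrite -ler_expR lnK ?posrE ?ltr0n; last by case: n n3.
apply: (@le_trans _ _ 3%:R); last by rewrite ler_nat.
have := expR_ge1Dx (- (1 / 2) : R); rewrite expRN => h.
have : (1 - 1 / 2) * expR (1 / 2) <= 1 :> R.
  by rewrite -ler_pdivlMr// (div1r (expR _)).
by set e := expR _ in e0 *; lra.
Qed.

Lemma ln_grid_le n : (7 <= n)%N ->
  ln #|{ffun 'I_n -> 'I_(2 * n ^ 2).+1}|%:R <= n%:R ^+ 2 :> R.
Proof.
move=> n7; rewrite card_ffun !card_ord natrX lnXn ?ltr0n// -[leLHS]mulr_natl expr2.
rewrite ler_wpM2l// -ler_expR lnK ?posrE ?ltr0n//.
(* 1 + n^4 / 24 >= 2 n^2 + 1 as soon as n^2 >= 48. *)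
apply: le_trans (@expR_ge1Dxn R n%:R 3 (ler0n _ _)).
have n7R : 7 <= n%:R :> R by rewrite (ler_nat _ 7 n).
rewrite -natr1 natrM natrX (_ : 4`! = 24)%N//; set x := n%:R in n7R *.
have : 49 <= x ^+ 2 by nra.
rewrite (_ : x ^+ 4 = x ^+ 2 * x ^+ 2); last by ring.
by set y := x ^+ 2; nra.
Qed.

(* Points of norm about n / sqrt (ln n) such that no central hyperplane comes *)
(* within distance O(1) of more than its expected share of them.              *)
Lemma exists_points n : (400 <= n)%N ->
  let b := 23040 * ln n%:R / n%:R : R in
  let rate := 4 * Num.sqrt (b / 96) in
  1 <= n%:R * rate /\
  exists s : seq 'rV[R]_n, [/\ size s = (n ^ 3)%N,
    forall a, a \in s -> n%:R / 12 / b <= dotp a a <= 2 * n%:R / b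
    & forall xi, unit_sphere xi ->
      \sum_(a <- s) expR (- 192 * dotp a xi ^+ 2) <= 8 * (n%:R ^+ 3 * rate)].
Proof.
move=> n400; have := @ln_ge_half n (leq_trans (isT : 3 <= 400)%N n400).
move: (ln n%:R) => L L2 b rate.
have nR : 400 <= n%:R :> R by rewrite (ler_nat _ 400 n).
have n0 : 0 < n%:R :> R by rewrite ltr0n (leq_trans _ n400).
have c96 : 0 < 96 :> R by rewrite ltr0n.
have L0 : 0 < L by apply: lt_le_trans L2; rewrite div1r invr_gt0.
have cL : 0 < 23040 * L by apply: mulr_gt0 L0; rewrite ltr0n.
have b0 : 0 < b := divr_gt0 cL n0.
have rate0 : 0 < rate by rewrite mulr_gt0// sqrtr_gt0 (divr_gt0 b0 c96).
have rate2 : rate ^+ 2 = 3840 * L / n%:R.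
  rewrite exprMn sqr_sqrtr; last exact: ltW (divr_gt0 b0 c96).
  by rewrite /b; field; rewrite gt_eqF.
have nrate : 1 <= n%:R * rate.
  rewrite -(@ler_pXn2r _ 2) ?nnegrE ?mulr_ge0 ?(ltW n0) ?(ltW rate0)//.
  rewrite expr1n exprMn rate2
    (_ : n%:R ^+ 2 * (3840 * L / n%:R) = 3840 * L * n%:R); last first.
    by field; rewrite gt_eqF.
  by clear -nR L2; nra.
split => //.
have b2 : 2 * n%:R / b <= n%:R ^+ 2.
  rewrite ler_pdivrMr// /b
    (_ : n%:R ^+ 2 * (23040 * L / n%:R) = 23040 * L * n%:R); last first.
    by field; rewrite gt_eqF.
  by clear -nR L2; nra.
pose I := {ffun 'I_n -> 'I_(2 * n ^ 2).+1}.
pose v (g : I) := grid_point g; pose P (g : I) := 1 / 4 <= dotp (v g) (v g).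
(* Mesh n^-2 gives squared error n / n^4. The approximating grid point then has squared norm at
   least 1/2 - n^-3 >= 1/4, as [spread_points] requires. *)
have near (xi : 'rV[R]_n) : unit_sphere xi -> exists2 g : I, P g &
    dotp (xi - v g) (xi - v g) <= (n%:R ^+ 3)^-1.
  move=> xi1; have M0 : (0 < n ^ 2)%N by rewrite expn_gt0 (leq_trans _ n400).
  have [g] := grid_net M0 xi1.
  rewrite natrX (_ : _ / _ = (n%:R ^+ 3)^-1) => [gxi|]; last first.
    by field; rewrite gt_eqF.
  exists g => //; rewrite /P.
  have := dotp_sqrB_ge (xi - v g) xi.
  rewrite addrAC subrr add0r dotpNN (unit_sphere_dotp xi1) -/(v g).
  have : (n%:R ^+ 3)^-1 <= 1 / 4 :> R.
    rewrite div1r lef_pV2 ?posrE ?exprn_gt0//.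
    by rewrite !exprS expr0 mulr1; clear -nR; nra.
  move: gxi; rewrite -/(v g); clear; lra.
have [e|e] := pselect (exists i, P i); last first.
  case: e; have [xi xi1] : exists xi : 'rV[R]_n, unit_sphere xi.
    have n0' : (0 < n)%N by rewrite (leq_trans _ n400).
    exists (delta_mx ord0 (Ordinal n0')); rewrite /unit_sphere /=.
    rewrite (_ : dotp _ _ = 1) ?sqrtr1// /dotp (bigD1 (Ordinal n0'))//=.
    rewrite big1 => [|j j0]; first by rewrite !mxE !eqxx mulr1 addr0.
    by rewrite !mxE (negbTE j0) andbF mulr0.
  by have [g Pg _] := near xi xi1; exists g.
have n6 : (6 <= n)%N by rewrite (leq_trans _ n400).
have [s [sN ss sP]] := spread_points n6 b0 c96 (n ^ 3) e
  (fun i Pi => Pi : 1 / 4 <= dotp (v i) (v i)).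
exists s; split => // xi xi1.
have [g Pg gxi] := near xi xi1.
have n7 : (7 <= n)%N by rewrite (leq_trans _ n400).
(* With n^3 centres, the entropy n^2 of the net is absorbed by n^3 [rate], because n [rate] >= 1. *)
have H : \sum_(a <- s) slab 96 (v g) a <= 4 * (n%:R ^+ 3 * rate).
  apply: le_trans (sP g Pg) _; rewrite natrX -/rate.
  have := ln_grid_le n7; rewrite -/I => h.
  have : n%:R ^+ 2 <= n%:R ^+ 3 * rate :> R.
    by rewrite (exprSr _ 2) -mulrA ler_peMr// exprn_ge0// ltW.
  by move: h; move: (ln _) (_ * rate) => x y; clear; lra.
rewrite (_ : 8 * _ = 2 * (4 * (n%:R ^+ 3 * rate))); last by ring.
apply: le_trans (ler_wpM2l (ler0n R 2) H).
rewrite mulr_sumr big_seq [leRHS]big_seq; apply: ler_sum => a sa.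
have e2 : expR (1 / 2) <= 2 :> R.
  have := expR_ge1Dx (- (1 / 2) : R); rewrite expRN => h.
  have : (1 - 1 / 2) * expR (1 / 2) <= 1 :> R.
    by rewrite -ler_pdivlMr ?expR_gt0// (div1r (expR _)).
  by clear; lra.
apply: le_trans (ler_wpM2r (expR_ge0 _) e2); rewrite -expRD ler_expR.
set u := dotp a xi; set u' := dotp a (v g).
(* Passing from the net to [xi]: u'^2 <= 2 u^2 + 2 (u - u')^2 doubles the exponent 96 to 192 and
   costs a factor e^{192/400} <= e^{1/2} <= 2. *)
have d2 : (u - u') ^+ 2 <= n%:R^-1.
  rewrite /u /u' -dotpBr; apply: le_trans (dotp_CauchySchwarz _ _) _.
  have /andP[_ aR] := ss a sa.
  rewrite (_ : n%:R^-1 = n%:R ^+ 2 * (n%:R ^+ 3)^-1); last by field; rewrite gt_eqF.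
  by apply: ler_pM; rewrite ?dotp_ge0//; apply: le_trans b2.
have : n%:R^-1 <= 1 / 400 :> R.
  by rewrite div1r lef_pV2 ?posrE; [exact: nR|exact: n0|rewrite ltr0n].
move: (sqr_ge0 (2 * u - u')) d2; move: u u' (n%:R^-1) => u u' x.
by clear; nra.
Qed.

End point_set.


(** * Lower bounds for the comparison constant *)

Section conclusion.
Context (R : realType).

(** Take K = L a ball and f the plain Gaussian. The bounds on the mass show that it is finite and
    positive, so it cancels. *)
Lemma comparison_const_ge1 n (C : R) : (3 <= n)%N -> 0 < C ->
  @comparison_const R n C -> 1 <= C.
Proof.
move=> n3 C0 cC; have n0 : 0 < n%:R :> R by rewrite ltr0n (leq_trans _ n3).
pose l := Num.sqrt (2 * n%:R : R); have l0 : 0 < l by rewrite sqrtr_gt0 mulr_gt0.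
have l2 : l ^+ 2 = 2 * n%:R by rewrite sqr_sqrtr// mulr_ge0// ltW.
pose f := bump_density 0 1 ([::] : seq 'rV[R]_n).
have := cC f (hull_body [::] l) (hull_body [::] l)
  (@continuous_bump_density _ _ _ _ _)
  (bump_density_gt0 _ _ (lexx 0)) (bump_density_even _ _ _)
  (hull_body_convex_body _ l0) (@hull_body_symmetric _ _ _ _)
  (hull_body_convex_body _ l0) (@hull_body_symmetric _ _ _ _)
  (fun xi _ => lexx _).
have lo := mu_density_ball_ge 1 ([::] : seq 'rV[R]_n) (lexx 0) (ltW l0).
have nosmall (a : 'rV[R]_n) : a \in [::] -> 0 <= dotp a a / 2 - l ^+ 2 by [].
have hi := mu_density_ball_le (lexx 0) ltr01 (ltW l0) nosmall.
rewrite -/f in lo hi *; rewrite mul0r addr0 in hi.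
have J0 : 0 < gaussJ 1 ^+ n :> R by rewrite exprn_gt0// gaussJ_gt0.
set m := mu_density _ _ in lo hi *.
have mfin : m \is a fin_num.
  by rewrite fin_numElt (lt_le_trans _ lo) ?ltNyr// (le_lt_trans hi) ?ltry.
rewrite -(fineK mfin) -EFinM lee_fin => h.
have m0 : 0 < fine m.
  move: lo; rewrite -(fineK mfin) lee_fin; apply: lt_le_trans.
  rewrite mulr_gt0// l2 mulrAC mulfV// mul1r.
  by have := @tail_hi_le R n n3; clear; lra.
by rewrite -(ler_pM2r m0) mul1r.
Qed.

(* Short vectors, half-spaces and bumps each contribute at most 1/8 of the    *)
(* total Gaussian section on the left (A is the value that makes this true of *)
(* the bumps), while the ball captures at least 3/4 of it on the right.       *)
Lemma mu_section_hull_le_ball n (s : seq 'rV[R]_n) (l r b rate : R) :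
  let A := gaussJ 1 ^+ n.-1 /
    (128 * (n%:R ^+ 3 * rate) * gaussJ 192 ^+ n.-1) in
  (400 <= n)%N -> 0 < ln n%:R :> R -> 0 < rate ->
  b = 23040 * ln n%:R / n%:R -> 0 < b ->
  0 < l -> l ^+ 2 = 2 * n%:R -> 0 < r -> r ^+ 2 = n%:R / 96 ->
  size s = (n ^ 3)%N ->
  (forall a, a \in s -> dotp a a <= 2 * n%:R / b) ->
  (forall xi, unit_sphere xi ->
    \sum_(a <- s) expR (- 192 * dotp a xi ^+ 2) <= 8 * (n%:R ^+ 3 * rate)) ->
  forall xi, unit_sphere xi ->
    (mu_section (bump_density A 192 s) (hull_body s r) xi <=
     mu_section (bump_density A 192 s) (hull_body [::] l) xi)%E.
Proof.
move=> A n400 L0 rate0 bE b0 l0 l2 r0 r2 sN sM sS xi xi1.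
have nR : 400 <= n%:R :> R by rewrite (ler_nat _ 400 n).
have n0 : 0 < n%:R :> R by rewrite ltr0n (leq_trans _ n400).
have n1 : n = n.-1.+1 by rewrite prednK// (leq_trans _ n400).
have nm : n%:R = n.-1%:R + 1 :> R by rewrite {1}n1 natr1.
have m6 : (6 <= n.-1)%N by rewrite -ltnS -n1 (leq_trans _ n400).
have Ln : expR (ln n%:R) = n%:R :> R by rewrite lnK// posrE.
have k0 : 0 < 192 :> R by rewrite ltr0n.
have J0 := gaussJ_gt0 (ltr01 : 0 < 1 :> R); have Jk0 := gaussJ_gt0 k0.
have N0 : 0 < n%:R ^+ 3 :> R by rewrite exprn_gt0.
have A0 : 0 < A.
  apply: divr_gt0; first exact: exprn_gt0.
  by rewrite pmulr_lgt0 ?exprn_gt0// pmulr_lgt0 ?mulr_gt0// ltr0n.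
apply: le_trans (mu_section_ball_ge 192 s (ltW A0) (ltW l0) xi1).
pose M := 2 * n%:R / b; have M0 : 0 < M by rewrite divr_gt0// mulr_gt0.
pose T : R := n%:R / 48.
have T0 : 0 < T by apply: divr_gt0 n0 _; rewrite ltr0n.
(* Since u^2 > n/24, both T = n/48 and r u, with r = sqrt(n/96), are below u^2 / 2. *)
have tT (u : R) : 0 <= u -> n.-1%:R / 12 < u ^+ 2 -> T + r * u < u ^+ 2.
  move=> u0 tu; have u24 : n%:R / 24 < u ^+ 2.
    by apply: le_lt_trans tu; move: nR; rewrite nm; clear; lra.
  have u2 : 0 < u.
    rewrite lt_neqAle u0 andbT eq_sym; apply/eqP => uE.
    by move: u24; rewrite uE expr0n /= ltNge divr_ge0// ltW.
  have ru : r < u / 2.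
    rewrite -(@ltr_pXn2r _ 2) ?nnegrE ?(ltW r0) ?divr_ge0//.
    by rewrite r2 expr_div_n; move: u24; clear; lra.
  have {}ru : r * u < u / 2 * u by rewrite ltr_pM2r.
  by rewrite /T; move: u24 ru; clear; rewrite expr2; lra.
have H := mu_section_hull_le (ltW A0) k0 xi1 (ltW T0) (ltW (divr_gt0 T0 M0)) tT sM.
apply: le_trans H _; rewrite lee_fin.
have lo := @tail_lo_le R n.-1 m6.
have hi := @tail_hi_le R n.-1 (leq_trans (isT : 3 <= 6)%N m6).
(* The tilt T / M minimises the exponent, with value - T^2 / M. The constant 23040 = 5 x 2 x 48^2 in
   b makes this -5 ln n, so the n^3 pairs of half-spaces contribute 2 / n^2 in all. *)
have -> : (T / M) ^+ 2 * M - 2 * (T / M) * T = - (5%:R * ln n%:R).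
  rewrite (_ : _ - _ = - (T ^+ 2 / M)); last by field; rewrite gt_eqF.
  by rewrite /T /M bE; field; rewrite !gt_eqF.
have -> : 3 * (n.-1%:R / 12) = n.-1%:R / 4 :> R by field.
rewrite sN natrX expRN expRM_natl Ln.
have N5 : 2 * n%:R ^+ 3 * (n%:R ^+ 5)^-1 <= 1 / 8 :> R.
  have -> : 2 * n%:R ^+ 3 * (n%:R ^+ 5)^-1 = 2 / n%:R ^+ 2 :> R.
    by field; rewrite gt_eqF.
  by rewrite ler_pdivrMr ?exprn_gt0//; move: nR; clear; nra.
have bumps : A * (gaussJ 192 ^+ n.-1 *
    (2 * \sum_(a <- s) expR (- 192 * dotp a xi ^+ 2))) <=
    gaussJ 1 ^+ n.-1 * (1 / 8).
  apply: (@le_trans _ _ (A * (gaussJ 192 ^+ n.-1 * (2 * (8 * (n%:R ^+ 3 * rate)))))).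
    rewrite ler_wpM2l ?(ltW A0)// ler_wpM2l ?exprn_ge0 ?(ltW Jk0)//.
    by rewrite ler_wpM2l// sS.
  rewrite le_eqVlt; apply/orP; left; apply/eqP; rewrite /A.
  move: (gaussJ 192 ^+ n.-1) (exprn_gt0 n.-1 Jk0) => G G0.
  by field; rewrite !gt_eqF.
apply: le_trans (lerD (lexx _) bumps) _.
rewrite -mulrDr ler_wpM2l ?exprn_ge0 ?(ltW J0)//.
have tail : expR (- (l ^+ 2 / 2)) * Num.sqrt 2 ^+ n.-1 <= 1 / 4 :> R.
  apply: le_trans hi; rewrite ler_wpM2r ?exprn_ge0 ?sqrtr_ge0// ler_expR l2.
  by rewrite nm; move: (ler0n R n.-1); clear; lra.
move: lo N5 tail; clear; lra.
Qed.

End conclusion.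

Section large_dimension.
Context (R : realType).

(** In units of the central Gaussian mass, K has mass at least a constant over [rate] and L at most
    2, so C is at least a constant over [rate]. *)
Lemma comparison_const_ge_large n (C : R) : (400 <= n)%N -> 0 < C ->
  1200 ^+ 2 <= n%:R / ln n%:R :> R ->
  @comparison_const R n C -> Num.sqrt (n%:R / ln n%:R) <= 2 ^+ 20 * C.
Proof.
move=> n400 C0 qQ cC; have [nrate [s [sN ss sS]]] := @exists_points R n n400.
have n0 : 0 < n%:R :> R by rewrite ltr0n (leq_trans _ n400).
have n1 : n = n.-1.+1 by rewrite prednK// (leq_trans _ n400).
have L0 : 0 < ln n%:R :> R.
  apply: lt_le_trans (ln_ge_half _ (leq_trans (isT : 3 <= 400)%N n400)).
  by rewrite div1r invr_gt0.
pose b : R := 23040 * ln n%:R / n%:R.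
rewrite -/b in nrate ss sS.
pose rate : R := 4 * Num.sqrt (b / 96).
rewrite -/rate in nrate sS.
have c96 : 0 < 96 :> R by rewrite ltr0n.
have b0 : 0 < b by apply: divr_gt0 n0; apply: mulr_gt0 L0; rewrite ltr0n.
have rate0 : 0 < rate by rewrite mulr_gt0// sqrtr_gt0 (divr_gt0 b0 c96).
have qrate : rate * Num.sqrt (n%:R / ln n%:R) <= 64.
  rewrite /rate -mulrA -sqrtrM ?(ltW (divr_gt0 b0 c96))//.
  have -> : b / 96 * (n%:R / ln n%:R) = 15 * 4 ^+ 2.
    by rewrite /b; move: (ln n%:R) L0 => L L0; field; rewrite !gt_eqF.
  rewrite sqrtrM// sqrtr_sqr ger0_norm//.
  have : Num.sqrt 15 <= 4 :> R.
    by rewrite -[leRHS]ger0_norm// -sqrtr_sqr ler_wsqrtr//; clear; lra.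
  by clear; lra.
pose l := Num.sqrt (2 * n%:R : R).
have l0 : 0 < l by rewrite sqrtr_gt0 mulr_gt0.
have l2 : l ^+ 2 = 2 * n%:R by rewrite sqr_sqrtr// mulr_ge0// ltW.
pose r := Num.sqrt (n%:R / 96 : R).
have r0 : 0 < r by rewrite sqrtr_gt0 divr_gt0.
have r2 : r ^+ 2 = n%:R / 96 by rewrite sqr_sqrtr// ltW// divr_gt0.
have k0 : 0 < 192 :> R by rewrite ltr0n.
have J0 := gaussJ_gt0 (ltr01 : 0 < 1 :> R); have Jk0 := gaussJ_gt0 k0.
have N0 : 0 < n%:R ^+ 3 :> R by rewrite exprn_gt0.
have Nr0 : 0 < 128 * (n%:R ^+ 3 * rate).
  by apply: mulr_gt0 (mulr_gt0 N0 rate0); rewrite ltr0n.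
pose A := gaussJ 1 ^+ n.-1 / (128 * (n%:R ^+ 3 * rate) * gaussJ 192 ^+ n.-1).
have A0 : 0 < A.
  apply: divr_gt0; first exact: exprn_gt0.
  by apply: mulr_gt0 Nr0 _; rewrite exprn_gt0.
have sM a : a \in s -> dotp a a <= 2 * n%:R / b by move=> /ss/andP[].
have sec := mu_section_hull_le_ball n400 L0 rate0 (erefl b) b0 l0 l2 r0 r2 sN sM sS.
rewrite -/A in sec.
have := cC (bump_density A 192 s) (hull_body s r) (hull_body [::] l)
  (@continuous_bump_density _ _ _ _ _)
  (bump_density_gt0 _ _ (ltW A0)) (bump_density_even _ _ _)
  (hull_body_convex_body _ r0) (@hull_body_symmetric _ _ _ _)
  (hull_body_convex_body _ l0) (@hull_body_symmetric _ _ _ _) sec.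
pose t := n%:R / 12 / b / 2 - l ^+ 2.
have st a : a \in s -> t <= dotp a a / 2 - l ^+ 2.
  by move=> /ss/andP[h _]; rewrite lerB// ler_wpM2r// invr_ge0.
(* 1200^2 / 23040 > 60 puts half the squared norm of each centre above 60 n / 24 = 5n/2, beyond l^2
   = 2n. *)
have tn : n%:R / 48 <= t.
  have q60 : 60 <= n%:R / ln n%:R / 23040 :> R.
    rewrite ler_pdivlMr ?ltr0n//; apply: le_trans qQ.
    by clear; lra.
  rewrite /t l2 (_ : n%:R / 12 / b / 2 = n%:R * (n%:R / ln n%:R / 23040) / 24).
    move: q60 n0; move: (_ / 23040) => x; clear; nra.
  by rewrite /b; move: (ln n%:R) L0 => L L0; field; rewrite !gt_eqF.
have muK := mu_density_hull_ge s (ltW A0) k0 (ltW r0).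
have muL := mu_density_ball_le (ltW A0) k0 (ltW l0) st.
move=> H; have Ce : (0 <= C%:E)%E by rewrite lee_fin ltW.
have {muK muL H} := le_trans muK (le_trans H (lee_wpmul2l Ce muL)).
rewrite -EFinM lee_fin sN natrX.
have -> : - (192 * r ^+ 2 / 2) = - n%:R by rewrite r2; field.
(* The masses have one more dimension than the sections that fixed A, which leaves this
   one-dimensional ratio, equal to 1 / sqrt 192. *)
pose j := gaussJ 192 / gaussJ 1 : R.
pose Jn := gaussJ 1 ^+ n : R; have Jn0 : 0 < Jn by rewrite exprn_gt0.
have AJ : A * (n%:R ^+ 3 * gaussJ 192 ^+ n) = Jn * (j / (128 * rate)).
  rewrite /Jn /j {2 3}n1 !exprS /A.
  have := exprn_gt0 n.-1 Jk0; move: (gaussJ 192 ^+ n.-1) => G G0.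
  by field; rewrite !gt_eqF.
have j0 : 0 < j by rewrite divr_gt0.
have j2 : j ^+ 2 = 1 / 192.
  rewrite /j expr_div_n /gaussJ !sqr_sqrtr ?divr_ge0 ?pi_ge0 ?ler0n//.
  by move: pi (pi_gt0 R) => p p0; field; rewrite gt_eqF.
have j1 : j <= 1 by move: j0 j2; clear; move: j => x; nra.
have j14 : 1 / 14 <= j by move: j0 j2; clear; move: j => x; nra.
pose u : R := expR (- n%:R) * Num.sqrt 2 ^+ n.
have u4 : u <= 1 / 4 := tail_hi_le R (leq_trans (isT : 3 <= 400)%N n400).
pose w : R := expR (- (192 * t / 2)) * Num.sqrt 2 ^+ n.
have w0 : 0 <= w by rewrite mulr_ge0 ?expR_ge0// exprn_ge0// sqrtr_ge0.
(* Here 192 t / 2 >= 2n, so w <= e^{-n} u, and e^{-n} <= 1/n <= [rate]. *)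
have wrate : w <= rate.
  apply: (@le_trans _ _ (expR (- n%:R) * u)).
    rewrite mulrA ler_wpM2r ?exprn_ge0 ?sqrtr_ge0// -expRD ler_expR.
    by move: tn; move: (t) => x; clear; lra.
  apply: (@le_trans _ _ (expR (- n%:R) * 1)).
    by rewrite ler_wpM2l ?expR_ge0//; move: u4; clear; lra.
  rewrite mulr1 expRN -[leRHS]invrK lef_pV2 ?posrE ?expR_gt0 ?invr_gt0//.
  apply: le_trans (expR_ge1Dx _); rewrite -[rate^-1]mul1r ler_pdivrMr//.
  by move: nrate rate0; move: (rate) => x; clear; nra.
have -> : A * (n%:R ^+ 3 * (gaussJ 192 ^+ n *
    (1 - expR (- n%:R) * Num.sqrt 2 ^+ n))) =
    A * (n%:R ^+ 3 * gaussJ 192 ^+ n) * (1 - u) by rewrite /u; ring.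
have -> : A * (n%:R ^+ 3 * (2 * (expR (- (192 * t / 2)) *
    (Num.sqrt 2 ^+ n * gaussJ 192 ^+ n)))) =
    A * (n%:R ^+ 3 * gaussJ 192 ^+ n) * (2 * w) by rewrite /w; ring.
rewrite AJ -/Jn.
have -> : C * (Jn + Jn * (j / (128 * rate)) * (2 * w)) =
    Jn * (C * (1 + j * (w / (64 * rate)))) by field; rewrite gt_eqF.
rewrite -mulrA ler_pM2l// => H.
have w1 : w / (64 * rate) <= 1.
  have r64 : 0 < 64 * rate by apply: mulr_gt0 rate0; rewrite ltr0n.
  rewrite (ler_pdivrMr _ _ r64) mul1r; apply: le_trans wrate _.
  by move: rate0; clear; move: (rate) => x; lra.
have {}H : j / (128 * rate) * (3 / 4) <= C * 2.
  apply: (@le_trans _ _ (j / (128 * rate) * (1 - u))).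
    rewrite ler_wpM2l//; last by move: u4; clear; lra.
    by rewrite ltW// divr_gt0// mulr_gt0// ltr0n.
  apply: le_trans H _; rewrite ler_wpM2l ?(ltW C0)//.
  have : j * (w / (64 * rate)) <= 1 * 1.
    apply: ler_pM => //; first exact: ltW.
    by rewrite divr_ge0// mulr_ge0 ?ler0n// ltW.
  by clear; lra.
have {}H : rate^-1 <= 1024 * 14 / 3 * C.
  have : 1 / 14 * rate^-1 <= j * rate^-1 by rewrite ler_wpM2r// invr_ge0 ltW.
  have : j / (128 * rate) = j * rate^-1 / 128 by field; rewrite gt_eqF.
  by move: H => /[swap] ->; move: (j * rate^-1) (rate^-1) => x y; clear; lra.
have : Num.sqrt (n%:R / ln n%:R) <= 64 * rate^-1.
  by rewrite ler_pdivlMr// mulrC.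
move=> /le_trans; apply.
move: H C0; move: (rate^-1) => x; clear.
have -> : 2 ^+ 20 = 1024 * 1024 :> R by rewrite (exprM _ 10 2); ring.
by lra.
Qed.

End large_dimension.

Theorem theorem1p3 (R : realType) :
  exists c : R, 0 < c /\
    forall n : nat, (3 <= n)%N ->
      ((c * Num.sqrt (n%:R / ln n%:R))%:E <= busemann_petty_const R n)%E.
Proof.
(* 2^20 exceeds both 64 x 1024 x 14 / 3, from large dimension, and 1200, from the remaining case. *)
exists (2 ^+ 20)^-1; split; first by rewrite invr_gt0 exprn_gt0.
move=> n n3; apply: le_ereal_inf_tmp => _ [C [C0 cC] <-]; rewrite lee_fin.
rewrite mulrC ler_pdivrMr ?exprn_gt0// [leRHS]mulrC.
have [q|q] := leP (1200 ^+ 2) (n%:R / ln n%:R : R); last first.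
  have C1 := comparison_const_ge1 n3 C0 cC.
  apply: (@le_trans _ _ 1200).
    rewrite -[leRHS]ger0_norm ?ler0n// -sqrtr_sqr.
    by apply: ler_wsqrtr; exact: ltW.
  have -> : 2 ^+ 20 = 1024 * 1024 :> R by rewrite (exprM _ 10 2); ring.
  by move: C1; clear; lra.
apply: comparison_const_ge_large => //.
(* For n < 400, ln n >= 1/2 keeps n / ln n below 800, contradicting the threshold. *)
rewrite leqNgt; apply/negP => n400; move: q; apply/negP; rewrite -ltNge.
have L2 := @ln_ge_half R n n3.
have L0 : 0 < ln n%:R :> R by apply: lt_le_trans L2; rewrite div1r invr_gt0.
rewrite ltr_pdivrMr//; apply: (@lt_le_trans _ _ 400%:R); first by rewrite ltr_nat.
by move: L2; clear; lra.
Qed.
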